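(* Not all polytopes of dimension three or higher occur as tight spans of coarsest subdivisions of point configurations. In particular, there is no point configuration $\mathcal A$ and coarsest subdivision $\Sigma$ of $\mathcal A$ whose tight span is (combinatorially) a prism over a triangle.
   Context: A point configuration is a finite multiset $\mathcal A\subset\mathbb R^d$ with affine hull $\mathbb R^d$. Subdivisions (not necessarily regular): collections of subconfigurations closed under faces, covering $\operatorname{conv}\mathcal A$ by convex hulls with pairwise disjoint relative interiors. A subdivision is coarsest if it is non-trivial and the only subdivisions coarsening it (each of its faces lies in a face of the other) are itself and the trivial subdivision (all faces of $\mathcal A$). The tight span of $\Sigma$ is the polyhedral complex with face poset anti-isomorphic to the poset of interior faces (not contained in $\partial\operatorname{conv}\mathcal A$) of $\Sigma$. *)

(* Defs.v *)
From HB Require Import structures.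
From mathcomp Require Import all_boot all_order all_algebra.
From mathcomp Require Import mathcomp_extra boolp classical_sets functions.
From mathcomp Require Import cardinality reals topology normedtype.

Set Implicit Arguments.
Unset Strict Implicit.
Unset Printing Implicit Defensive.
Import Order.TTheory GRing.Theory Num.Theory.
Import numFieldNormedType.Exports.
Local Open Scope classical_set_scope.
Local Open Scope ring_scope.

Section ConvexGeometry.
Context {R : realType}.

Definition affhull n (X : set 'rV[R]_n) : set 'rV[R]_n :=
  [set x | exists (k : nat) (v : 'I_k -> 'rV[R]_n) (w : 'I_k -> R),
    [/\ forall i, X (v i), \sum_i w i = 1 & x = \sum_i w i *: v i]].

Definition convhull n (X : set 'rV[R]_n) : set 'rV[R]_n :=
  [set x | exists (k : nat) (v : 'I_k -> 'rV[R]_n) (w : 'I_k -> R),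
    [/\ forall i, X (v i), forall i, 0 <= w i, \sum_i w i = 1
      & x = \sum_i w i *: v i]].

Definition relint n (C : set 'rV[R]_n) : set 'rV[R]_n :=
  [set x | C x /\ \forall y \near x, affhull C y -> C y].

Definition bdry n (C : set 'rV[R]_n) : set 'rV[R]_n :=
  closure C `\` interior C.

Definition dot n (c x : 'rV[R]_n) : R := \sum_(j < n) c 0 j * x 0 j.

Definition polytope n (P : set 'rV[R]_n) : Prop :=
  exists2 X : set 'rV[R]_n, finite_set X & P = convhull X.

(* The inequality dot c x <= b may be trivial (c = 0), so both P itself and
   the empty set are faces of P. *)
Definition polyface n (P G : set 'rV[R]_n) : Prop :=
  exists (c : 'rV[R]_n) (b : R),
    (forall x, P x -> dot c x <= b) /\ G = [set x | P x /\ dot c x = b].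

Definition has_dim n (P : set 'rV[R]_n) (k : nat) : Prop :=
  exists (x0 : 'rV[R]_n) (U : {vspace 'rV[R]_n}),
    affhull P = [set x | x - x0 \in U] /\ \dim U = k.

(* The polyhedral complex of all (nonempty) faces of P. *)
Definition face_complex n (P : set 'rV[R]_n) : set (set 'rV[R]_n) :=
  [set G | polyface P G /\ G !=set0].

Definition triangle : set 'rV[R]_2 :=
  convhull [set x | [\/ x = 0, x = delta_mx 0 0 | x = delta_mx 0 1]].

Definition prism n (Q : set 'rV[R]_n) : set 'rV[R]_(n + 1) :=
  [set z | exists (y : 'rV[R]_n) (t : R),
    [/\ Q y, 0 <= t <= 1 & z = row_mx y (const_mx t)]].

End ConvexGeometry.

(* A finite multiset of points is a finite family; subconfigurations are sets
   of labels, so repeated points can be selected independently. *)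
Record pointConfig (R : realType) (d : nat) := PointConfig {
  label : finType;
  pt : label -> 'rV[R]_d;
  pt_span : affhull (range pt) = setT }.

Section Subdivisions.
Context {R : realType} {d : nat}.
Variable A : pointConfig R d.
Implicit Types (F G : {set label A}) (S T : {set {set label A}}).

Definition hull F : set 'rV[R]_d := convhull (@pt R d A @` [set` F]).

(* G consists of all the labels of F whose point lies on some face of hull F;
   the empty subconfiguration is thus a face of every F. *)
Definition face F G : Prop :=
  exists2 Phi : set 'rV[R]_d, polyface (hull F) Phi &
    forall i, i \in G <-> i \in F /\ Phi (pt i).

Definition subdivision S : Prop :=
  [/\ forall F G, F \in S -> face F G -> G \in S,
      \bigcup_(F in [set` S]) hull F = hull finset.setT
    & forall F G, F \in S -> G \in S -> F <> G ->
        relint (hull F) `&` relint (hull G) = set0].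

Definition trivial_subdivision S : Prop :=
  forall F, F \in S <-> face finset.setT F.

Definition coarsens T S : Prop :=
  forall F, F \in S -> exists2 G, G \in T & F \subset G.

Definition coarsest S : Prop :=
  [/\ subdivision S, ~ trivial_subdivision S
    & forall T, subdivision T -> coarsens T S ->
        T = S \/ trivial_subdivision T].

Definition interior_face S F : Prop :=
  F \in S /\ ~ (hull F `<=` bdry (hull finset.setT)).

(* K, ordered by inclusion, is anti-isomorphic to the poset of interior faces
   of S; f is injective on interior faces by the last clause. *)
Definition is_tight_span S n (K : set (set 'rV[R]_n)) : Prop :=
  exists f : {set label A} -> set 'rV[R]_n,
    [/\ forall F, interior_face S F -> K (f F),
        forall C, K C -> exists2 F, interior_face S F & f F = C
      & forall F G, interior_face S F -> interior_face S G ->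
          (F \subset G <-> f G `<=` f F)].

End Subdivisions.

(* Main.v *)
Require Import Defs.
From HB Require Import structures.
From mathcomp Require Import all_boot all_order all_algebra.
From mathcomp Require Import mathcomp_extra boolp classical_sets functions.
From mathcomp Require Import cardinality reals topology normedtype.
From mathcomp Require Import ring lra.
Set Implicit Arguments.
Unset Strict Implicit.
Unset Printing Implicit Defensive.
Import Order.TTheory GRing.Theory Num.Theory.
Import numFieldNormedType.Exports.
Local Open Scope classical_set_scope.
Local Open Scope ring_scope.

(* Let F0 be the interior face dual to the whole prism and p0 a relative interior
   point of F0. Seen from p0, the interior faces form a complete fan of cones
   whose face poset, modulo the linear space L spanned by F0, is that of the
   boundary of a triangular bipyramid: apices u_true, u_false (dual to the two
   triangles) and equatorial vertices x_0, x_1, x_2 (dual to the three squares),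
   every cone being generated by L and its vertices. Completeness of the fan and
   uniqueness of supports leave two cases.
   - Some positive combination of the x_k lies in L. Then the x_k span a hyperplane
     modulo L separating the apices, and merging the three cells around each apex
     yields the subdivision into two halves.
   - Otherwise the x_k are independent modulo L, one apex is a positive and the
     other a negative combination of them. Merging the three cells around the
     former gives the convex cone over the equator and again a subdivision.
   In both cases the merged subdivision is a proper, non-trivial coarsening. *)

(** * Functionals and the Farkas lemma *)

(** A cell is a set of labels, not a polytope: it may contain labels that are no vertices, and two
    cells can meet properly as polytopes while disagreeing on which labels lie in the intersection.
    Hence relative interiors are replaced by strictly positive combinations of labels, disjointness
    becomes uniqueness of the cell carrying a point, and merged cells must select the same labels on
    the hyperplane that separates them. The two cases come from one device: a linear relation modulo
    L is written with nonnegative coefficients on both sides; if both supports are faces of the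
    bipyramid they must coincide. This forces the signs in every relation between the vertices. The
    merged subdivision is given by a list of cells and consists of all their faces, so only pairs of
    listed cells need comparing. The claim on all polytopes follows from the prism, itself a
    polytope of dimension 3. *)

Section Dot.
Context {R : realType} {n : nat}.
Implicit Types (c x y : 'rV[R]_n) (a : R).

Lemma dotDr c x y : dot c (x + y) = dot c x + dot c y.
Proof.
by rewrite /dot -big_split; apply: eq_bigr => j _; rewrite mxE mulrDr.
Qed.

Lemma dotZr c a x : dot c (a *: x) = a * dot c x.
Proof. by rewrite /dot mulr_sumr; apply: eq_bigr => j _; rewrite mxE mulrCA. Qed.

Lemma dotDl c c' x : dot (c + c') x = dot c x + dot c' x.
Proof.
by rewrite /dot -big_split; apply: eq_bigr => j _; rewrite mxE mulrDl.
Qed.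

Lemma dotZl a c x : dot (a *: c) x = a * dot c x.
Proof. by rewrite /dot mulr_sumr; apply: eq_bigr => j _; rewrite mxE mulrA. Qed.

Lemma dot0r c : dot c 0 = 0.
Proof. by rewrite -(scale0r (0 : 'rV[R]_n)) dotZr mul0r. Qed.

Lemma dot0l x : dot 0 x = 0.
Proof. by rewrite -(scale0r (0 : 'rV[R]_n)) dotZl mul0r. Qed.

Lemma dotNr c x : dot c (- x) = - dot c x.
Proof. by rewrite -scaleN1r dotZr mulN1r. Qed.

Lemma dotNl c x : dot (- c) x = - dot c x.
Proof. by rewrite -scaleN1r dotZl mulN1r. Qed.

Lemma dotBr c x y : dot c (x - y) = dot c x - dot c y.
Proof. by rewrite dotDr dotNr. Qed.

Lemma dotBl c c' x : dot (c - c') x = dot c x - dot c' x.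
Proof. by rewrite dotDl dotNl. Qed.

Lemma dot_sumr (I : Type) (s : seq I) (P : pred I) (w : I -> R) g c :
  dot c (\sum_(i <- s | P i) w i *: g i) = \sum_(i <- s | P i) w i * dot c (g i).
Proof.
elim/big_rec2: _ => [|i a y _ <-]; first exact: dot0r.
by rewrite dotDr dotZr.
Qed.

Lemma dot_opp_self_lt0 x : x != 0 -> dot (- x) x < 0.
Proof.
move=> x0; rewrite dotNl oppr_lt0 lt_def; apply/andP; split; last first.
  by apply: sumr_ge0 => j _; rewrite -expr2 sqr_ge0.
apply: contra x0; rewrite /dot => /eqP /psumr_eq0P H.
apply/eqP/rowP => j; rewrite mxE; apply/eqP.
rewrite -sqrf_eq0 expr2; apply/eqP/H => // k _.
by rewrite -expr2 sqr_ge0.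
Qed.

End Dot.

(* Each new generator [g i] on the wrong side of the separating functional [c]
   is eliminated by projecting along it onto the kernel of [c]. *)
Lemma farkas_seq (R : realType) (n : nat) (I : eqType) (s : seq I)
    (g : I -> 'rV[R]_n) (b : 'rV[R]_n) : uniq s ->
  (exists2 w : I -> R, forall i, 0 <= w i & b = \sum_(i <- s) w i *: g i) \/
  (exists2 c, forall i, i \in s -> 0 <= dot c (g i) & dot c b < 0).
Proof.
elim: s g b => [|i0 s IH] g b /=.
  move=> _; have [->|b0] := eqVneq b 0.
    by left; exists (fun=> 0) => //; rewrite big_nil.
  by right; exists (- b) => //; apply: dot_opp_self_lt0.
case/andP=> i0s us.
have upd (w : I -> R) a (h : I -> 'rV[R]_n) :
    \sum_(i <- s) (if i == i0 then a else w i) *: h i = \sum_(i <- s) w i *: h i.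
  by apply: eq_big_seq => i si; case: eqP => // e; rewrite -e si in i0s.
have [[w w0 ->]|[c cg cb]] := IH g b us.
  left; exists (fun i => if i == i0 then 0 else w i) => [i|]; first by case: ifP.
  by rewrite big_cons eqxx scale0r add0r upd.
have [cu|cu] := leP 0 (dot c (g i0)).
  by right; exists c => // i; rewrite inE => /orP[/eqP->|/cg].
set u := g i0 in cu *.
have cu0 : dot c u != 0 by rewrite lt_eqF.
pose mu := dot c b / dot c u.
have mu0 : 0 <= mu by rewrite /mu -mulrNN -invrN divr_ge0 // oppr_ge0 ltW.
pose lam i := - (dot c (g i) / dot c u).
have lam0 i : i \in s -> 0 <= lam i.
  by move=> /cg ci; rewrite /lam -mulrN -invrN divr_ge0 // oppr_ge0 ltW.
have [[w w0 e]|[c' cg' cb']] := IH (fun i => g i + lam i *: u) (b - mu *: u) us.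
  left; exists (fun i => if i == i0 then mu + \sum_(i <- s) w i * lam i else w i).
    move=> i; case: ifP => // _; apply: addr_ge0 => //; rewrite big_seq.
    by apply: sumr_ge0 => j /lam0; apply: mulr_ge0.
  rewrite big_cons eqxx upd -(subrK (mu *: u) b) e.
  under eq_bigr => i _ do rewrite scalerDr scalerA.
  by rewrite big_split /= -scaler_suml [RHS]addrC [mu + _]addrC scalerDl addrA.
right; exists (c' - (dot c' u / dot c u) *: c) => [i|].
  rewrite inE => /orP[/eqP->|si].
    by rewrite -/u dotBl dotZl divfK // subrr.
  have := cg' _ si; rewrite dotDr dotZr dotBl dotZl /lam.
  by congr (0 <= _); field.
move: cb'; rewrite dotBr dotZr dotBl dotZl /mu.
by congr (_ < 0); field.
Qed.

Lemma farkas (R : realType) (n : nat) (I : finType)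
    (g : I -> 'rV[R]_n) (b : 'rV[R]_n) :
  (exists2 w : I -> R, forall i, 0 <= w i & b = \sum_i w i *: g i) \/
  (exists2 c, forall i, 0 <= dot c (g i) & dot c b < 0).
Proof.
have [[w w0 ->]|[c cg cb]] := farkas_seq g b (index_enum_uniq I).
  by left; exists w.
by right; exists c => // i; apply: cg; rewrite mem_index_enum.
Qed.

(** Serves every perturbation argument below. The whole interval of [e'] is kept so that a caller
    may shrink the step further. *)
Lemma small_step (R : realType) (I : finType) (P : pred I) (w g : I -> R) :
  (forall i, P i -> 0 < w i) ->
  exists2 e : R, 0 < e &
    forall e', 0 <= e' <= e -> forall i, P i -> 0 < w i + e' * g i.
Proof.
move=> w0.
suff [e e0 He] : exists2 e : R, 0 < e &
    forall e', 0 <= e' <= e -> forall i, i \in enum P -> 0 < w i + e' * g i.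
  by exists e => // e' /He H i Pi; apply: H; rewrite mem_enum.
have: forall i, i \in enum P -> 0 < w i by move=> i; rewrite mem_enum => /w0.
elim: (enum P) => [|i s IH] ws; first by exists 1.
have [|e e0 He] := IH; first by move=> j js; apply: ws; rewrite inE js orbT.
have wi : 0 < w i by apply: ws; rewrite mem_head.
have k0 : 0 < `|g i| + 1 by rewrite ltr_wpDl.
(* The [+ 1] avoids a zero denominator; the factor 2 makes the bound strict. *)
pose e1 := w i / 2 / (`|g i| + 1).
have e10 : 0 < e1 by rewrite !divr_gt0.
exists (Num.min e e1) => [|e' /andP[e'0]]; first by rewrite lt_min e0.
rewrite le_min => /andP[e'e e'e1] j; rewrite inE => /orP[/eqP->|]; last first.
  by apply: He; rewrite e'0.
have : `|e' * g i| < w i.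
  rewrite normrM (ger0_norm e'0).
  apply: le_lt_trans (_ : e1 * (`|g i| + 1) < _).
    by apply: ler_pM => //; rewrite lerDl.
  by rewrite /e1 divfK ?gt_eqF //; lra.
by rewrite ltr_norml => /andP[h _]; rewrite -ltrBlDl sub0r.
Qed.

(** * Hulls and faces *)

Section Hulls.
Context {R : realType} {d : nat} {A : pointConfig R d}.
Implicit Types (F G H : {set label A}) (r x y v c : 'rV[R]_d).

Lemma regroup_sum (V : lmodType R) k (j : 'I_k -> label A) (w : 'I_k -> R) F
    (h : label A -> V) : (forall i, j i \in F) ->
  \sum_i w i *: h (j i) = \sum_(l in F) (\sum_(i | j i == l) w i) *: h l.
Proof.
move=> jF; rewrite (partition_big j (mem F)) //=.
apply: eq_bigr => l _; rewrite scaler_suml.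
by apply: eq_bigr => i /eqP ->.
Qed.

Lemma regroup_weights k (j : 'I_k -> label A) (w : 'I_k -> R) F :
  (forall i, j i \in F) -> \sum_(l in F) \sum_(i | j i == l) w i = \sum_i w i.
Proof. by move=> jF; rewrite [RHS](partition_big j (mem F)) //=. Qed.

Lemma hullP F x : hull F x <-> exists w : label A -> R,
  [/\ forall i, i \in F -> 0 <= w i, \sum_(i in F) w i = 1
    & x = \sum_(i in F) w i *: pt i].
Proof.
split=> [[k [v [w [vF w0 w1 ->]]]]|[w [w0 w1 ->]]].
  have /choice[j jP] : forall i, exists l, l \in F /\ pt l = v i.
    by move=> i; have [l lF <-] := vF i; exists l.
  exists (fun l => \sum_(i | j i == l) w i); split.
  - by move=> l _; apply: sumr_ge0.
  - by rewrite regroup_weights // => i; case: (jP i).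
  rewrite -regroup_sum; last by move=> i; case: (jP i).
  by apply: eq_bigr => i _; case: (jP i) => _ ->.
exists #|F|, (fun i => pt (enum_val i)), (fun i => w (enum_val i)); split.
- by move=> i; exists (enum_val i) => //; apply: enum_valP.
- by move=> i; apply/w0/enum_valP.
- by rewrite -w1 [RHS](big_enum_val _).
- by rewrite (big_enum_val _).
Qed.

Lemma affhull_hull F x : affhull (hull F) x -> exists w : label A -> R,
  \sum_(i in F) w i = 1 /\ x = \sum_(i in F) w i *: pt i.
Proof.
case=> k [v [w [vF w1 ->]]].
have /choice[W WP] : forall i, exists w : label A -> R,
    [/\ forall i, i \in F -> 0 <= w i, \sum_(i in F) w i = 1
    & v i = \sum_(i in F) w i *: pt i] by move=> i; apply/hullP.
exists (fun l => \sum_i w i * W i l); split.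
  rewrite exchange_big /= -[RHS]w1; apply: eq_bigr => i _.
  by rewrite -mulr_sumr; case: (WP i) => _ -> _; rewrite mulr1.
under [RHS]eq_bigr => l _ do rewrite scaler_suml.
rewrite exchange_big; apply: eq_bigr => i _ /=.
case: (WP i) => _ _ ->; rewrite scaler_sumr.
by apply: eq_bigr => l _; rewrite scalerA.
Qed.

(** The algebraic form of the relative interior of [hull F]; see [relintP]. *)
Definition strict_hull F x : Prop := exists w : label A -> R,
  [/\ forall i, i \in F -> 0 < w i, \sum_(i in F) w i = 1
    & x = \sum_(i in F) w i *: pt i].

Lemma strict_hullW F x : strict_hull F x -> hull F x.
Proof.
by case=> w [w0 w1 xE]; apply/hullP; exists w; split=> // i /w0/ltW.
Qed.

Lemma hullS F G x : F \subset G -> hull F x -> hull G x.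
Proof.
move=> FG [k [v [w [vF w0 w1 xE]]]]; exists k, v, w; split=> // i.
by have [l lF <-] := vF i; exists l => //; apply: (fintype.subsetP FG).
Qed.

Lemma hull_pt F i : i \in F -> hull F (pt i).
Proof.
move=> iF; exists 1%N, (fun=> pt i), (fun=> 1).
by split=> [_|_||]; rewrite ?ler01 ?big_ord1 ?scale1r //; exists i.
Qed.

Lemma strict_hull_bary F : F != finset.set0 -> exists r, strict_hull F r.
Proof.
rewrite -card_gt0 => F0; exists (\sum_(i in F) #|F|%:R^-1 *: pt i).
exists (fun=> #|F|%:R^-1); split=> // [i _|].
  by rewrite invr_gt0 ltr0n.
by rewrite sumr_const -(mulr_natr #|F|%:R^-1) mulVf // pnatr_eq0 -lt0n.
Qed.

Lemma hull_neq0 F x : hull F x -> F != finset.set0.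
Proof.
move/hullP=> [w [_ + _]]; apply: contra_eqN => /eqP->.
by rewrite big_set0 eq_sym oner_neq0.
Qed.

Lemma strict_hull_mix F x y (t : R) : 0 < t <= 1 ->
  strict_hull F x -> hull F y -> strict_hull F (t *: x + (1 - t) *: y).
Proof.
case/andP=> t0 t1 [w [w0 w1 ->]] /hullP[w' [w'0 w'1 ->]].
exists (fun i => t * w i + (1 - t) * w' i); split.
- by move=> i iF; rewrite ltr_pwDl ?mulr_gt0 ?mulr_ge0 ?w0 ?w'0 ?subr_ge0.
- by rewrite big_split /= -!mulr_sumr w1 w'1 !mulr1 addrC subrK.
rewrite !scaler_sumr -big_split; apply: eq_bigr => i _ /=.
by rewrite !scalerA scalerDl.
Qed.

Lemma dot_hull_le F c (b : R) x : (forall i, i \in F -> dot c (pt i) <= b) ->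
  hull F x -> dot c x <= b.
Proof.
move=> cb /hullP[w [w0 w1 ->]]; rewrite dot_sumr -[b]mul1r -w1 mulr_suml.
by apply: ler_sum => i iF; rewrite ler_wpM2l ?w0 ?cb.
Qed.

(** A positively weighted average reaches an upper bound only if every term does. *)
Lemma dot_strict_hull_eq F c (b : R) x :
  (forall i, i \in F -> dot c (pt i) <= b) ->
  strict_hull F x -> dot c x = b -> forall i, i \in F -> dot c (pt i) = b.
Proof.
move=> cb [w [w0 w1 ->]]; rewrite dot_sumr => e i iF.
have/psumr_eq0P : \sum_(j in F) w j * (b - dot c (pt j)) = 0.
  under eq_bigr => j _ do rewrite mulrBr.
  by rewrite sumrB e -mulr_suml w1 mul1r subrr.
move=> /(_ _ i iF) H; apply/esym/subr0_eq.
have/eqP := H (fun j jF => mulr_ge0 (ltW (w0 j jF)) (etrans (subr_ge0 _ _) (cb j jF))).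
by rewrite mulf_eq0 gt_eqF ?w0 //= => /eqP.
Qed.

Lemma faceP F G : face F G <-> exists c (b : R),
  (forall i, i \in F -> dot c (pt i) <= b) /\
  (forall i, i \in G <-> i \in F /\ dot c (pt i) = b).
Proof.
split=> [[Phi [c [b [cb ->]]] GP]|[c [b [cb GP]]]].
  exists c, b; split=> [i iF|i]; first exact/cb/hull_pt.
  rewrite GP; split=> [[iF [_ ?]]//|[iF ?]].
  by split=> //; split=> //; apply: hull_pt.
exists [set x | hull F x /\ dot c x = b].
  by exists c, b; split=> // x; apply: dot_hull_le.
move=> i; rewrite GP; split=> [[iF ?]|[iF [_ ?]]//].
by split=> //; split=> //; apply: hull_pt.
Qed.

Lemma face_sub F G : face F G -> G \subset F.
Proof. by move/faceP=> [c [b [_ GP]]]; apply/fintype.subsetP => i /GP[]. Qed.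

Lemma face_refl F : face F F.
Proof.
by apply/faceP; exists 0, 0; split=> i; rewrite dot0l //; split=> [|[]].
Qed.

Lemma face_contains F G H r :
  face F G -> H \subset F -> strict_hull H r -> hull G r -> H \subset G.
Proof.
move=> /faceP[c [b [cb GP]]] HF Hr Gr.
have HF' i : i \in H -> i \in F by apply/(fintype.subsetP HF).
have e : dot c r = b.
  apply/le_anti/andP; split.
    by apply: (dot_hull_le _ Gr) => i /GP[_ ->].
  rewrite -lerN2 -dotNl; apply: (dot_hull_le _ Gr) => i /GP[_ e].
  by rewrite dotNl e.
apply/fintype.subsetP => i iH; apply/GP; split; first exact: HF'.
by apply: (dot_strict_hull_eq _ Hr e) => // j /HF'; apply: cb.
Qed.

Lemma face_uniq F G H r :
  face F G -> face F H -> strict_hull G r -> strict_hull H r -> G = H.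
Proof.
move=> FG FH Gr Hr; apply/eqP; rewrite finset.eqEsubset; apply/andP; split.
  by apply: (face_contains FH _ Gr); [apply: face_sub|apply: strict_hullW].
by apply: (face_contains FG _ Hr); [apply: face_sub|apply: strict_hullW].
Qed.

(* If H is cut out of G by (c', b') and G out of F by (c, b), then H is cut
   out of F by (c + e c', b + e b') for all small e > 0. *)
Lemma face_trans F G H : face F G -> face G H -> face F H.
Proof.
move=> /faceP[c [b [cb GP]]] /faceP[c' [b' [cb' HP]]]; apply/faceP.
pose out i := (i \in F) && (i \notin G).
have [|e e0 He] := @small_step R (label A) out (fun i => b - dot c (pt i))
    (fun i => b' - dot c' (pt i)).
  move=> i /andP[iF iG]; rewrite subr_gt0 lt_def cb // andbT.
  by apply: contra iG => /eqP e; apply/GP.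
have key i : i \in F -> dot c (pt i) + e * dot c' (pt i) <= b + e * b' /\
    (dot c (pt i) + e * dot c' (pt i) = b + e * b' -> i \in G).
  move=> iF; have [iG|iG] := boolP (i \in G).
    have [_ ->] := (GP i).1 iG; split=> //; rewrite lerD2l ler_pM2l //.
    exact: cb'.
  have := He e; rewrite ltW ?lexx //= => /(_ isT i); rewrite /out iF iG.
  move=> /(_ isT) h; have {}h : dot c (pt i) + e * dot c' (pt i) < b + e * b'.
    by rewrite -subr_gt0; congr (0 < _): h; ring.
  by split; [exact: ltW|move=> e'; rewrite e' ltxx in h].
exists (c + e *: c'), (b + e * b'); split=> i; rewrite dotDl dotZl.
  by move/key=> [].
split=> [/HP[iG ->]|[iF E]]; first by have [iF ->] := (GP i).1 iG.
have iG := (key i iF).2 E; apply/HP; split=> //.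
have [_ e1] := (GP i).1 iG; move: E; rewrite e1 => /addrI/mulfI; apply.
by rewrite gt_eqF.
Qed.

(** [G] collects the labels that get positive weight in some nonnegative relation among the vectors
    [pt j - r]. For any other label of [F], Farkas gives a functional nonnegative on all these
    vectors and positive on its own. The sum of these functionals exposes [G]; the sum of the
    relations represents [r] strictly. *)
Lemma carrier F r : hull F r -> exists2 G, face F G & strict_hull G r.
Proof.
move=> Fr.
pose g i : 'rV[R]_d := if i \in F then pt i - r else 0.
have alt i : i \in F ->
    (exists w : label A -> R, [/\ forall j, 0 <= w j, 0 < w i &
       \sum_(j in F) w j *: (pt j - r) = 0]) \/
    (exists c, (forall j, j \in F -> 0 <= dot c (pt j - r)) /\
       0 < dot c (pt i - r)).
  move=> iF; have [[w w0 e]|[c cg cb]] := farkas g (- (pt i - r)).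
    left; exists (fun j => w j + (j == i)%:R); split.
    - by move=> j; rewrite addr_ge0 // ler0n.
    - by rewrite eqxx ltr_wpDl.
    under eq_bigr => j _ do rewrite scalerDl.
    rewrite big_split /= (bigD1 i) //= [X in _ + X](bigD1 i) //=.
    rewrite [X in _ + (_ + X)]big1 => [|j /andP[_ /negPf->]]; last exact: scale0r.
    rewrite eqxx scale1r addr0 -(bigD1 i (P := mem F)) //=.
    apply/eqP; rewrite addr_eq0 e [eqbRHS](bigID (mem F)) /= [X in _ == _ + X]big1.
      by rewrite addr0; apply/eqP/eq_bigr => j jF; rewrite /g jF.
    by move=> j /negPf jF; rewrite /g jF scaler0.
  right; exists c; split=> [j jF|]; last by rewrite -oppr_lt0 -dotNr.
  by have := cg j; rewrite /g jF.
have [w0 [w00 w01 rE]] := (hullP F r).1 Fr.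
have zero0 : \sum_(j in F) w0 j *: (pt j - r) = 0.
  under eq_bigr => j _ do rewrite scalerBr.
  by rewrite sumrB -rE -scaler_suml w01 scale1r subrr.
pose Q i := exists w : label A -> R, [/\ forall j, 0 <= w j, 0 < w i &
       \sum_(j in F) w j *: (pt j - r) = 0].
pose G := [set i in F | `[< Q i >]]%SET.
have GP i : i \in G <-> i \in F /\ Q i.
  by rewrite inE; split=> [/andP[? /asboolP]|[-> /asboolP]].
have /choice[c cP] i : exists c, (forall j, j \in F -> 0 <= dot c (pt j - r)) /\
    (i \in F -> i \notin G -> 0 < dot c (pt i - r)).
  have [iF|iF] := boolP (i \in F); last first.
    by exists 0; split=> // j _; rewrite dot0l.
  have [Qi|[c [c0 ci]]] := alt i iF; last by exists c.
  exists 0; split=> [j _|_ /negP[]]; [by rewrite dot0l|exact/GP].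
pose C := \sum_(i in F) 1%R *: c i.
have dotC x : dot C x = \sum_(i in F) dot (c i) x.
  rewrite /C; elim/big_rec2: _ => [|i a z _ <-]; first exact: dot0l.
  by rewrite dotDl dotZl mul1r.
have C0 j : j \in F -> 0 <= dot C (pt j - r).
  by move=> jF; rewrite dotC; apply: sumr_ge0 => i _; apply: (cP i).1.
have FG : face F G.
  apply/faceP; exists (- C), (- dot C r); split=> i.
    by move/C0; rewrite dotBr dotNl subr_ge0 lerN2.
  rewrite GP dotNl; split=> -[iF].
    move=> [w [w1 wi e]]; split=> //; congr (- _); apply/subr0_eq.
    rewrite -dotBr; have := congr1 (dot C) e; rewrite dot0r dot_sumr.
    move/psumr_eq0P => /(_ (fun j jF => mulr_ge0 (w1 j) (C0 j jF)) i iF)/eqP.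
    by rewrite mulf_eq0 gt_eqF //= => /eqP.
  move/oppr_inj/eqP; rewrite -subr_eq0 -dotBr => /eqP e; split=> //.
  have [/GP[]//|iG] := boolP (i \in G).
  move: e; rewrite dotC (bigD1 i) //= => /eqP; rewrite gt_eqF //.
  apply: ltr_pwDl; first exact: (cP i).2.
  by apply: sumr_ge0 => k _; apply: (cP k).1.
exists G => //.
have /choice[W WP] i : exists w : label A -> R, [/\ forall j, 0 <= w j,
    i \in G -> 0 < w i & \sum_(j in F) w j *: (pt j - r) = 0].
  have [/GP[_ [w [w1 wi e]]]|iG] := boolP (i \in G); first by exists w.
  exists (fun=> 0); split=> //; rewrite big1 // => j _; exact: scale0r.
(* Including the convex representation [w0] of [r] keeps the total weight at least 1, so that it can
   be normalised. *)
pose V j := (if j \in F then w0 j else 0) + \sum_i W i j.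
have V0 j : 0 <= V j.
  apply: addr_ge0; first by case: ifP => // /w00.
  by apply: sumr_ge0 => i _; case: (WP i).
have VG j : j \in G -> 0 < V j.
  move=> jG; apply: ltr_wpDl; first by case: ifP => // /w00.
  rewrite (bigD1 j) //=; apply: ltr_pwDl; first by case: (WP j) => _ /(_ jG).
  by apply: sumr_ge0 => i _; case: (WP i).
have Vz : \sum_(j in F) V j *: (pt j - r) = 0.
  under eq_bigr => j jF do rewrite /V jF scalerDl scaler_suml.
  rewrite big_split /= zero0 add0r exchange_big big1 //= => i _.
  by case: (WP i).
(* [V] is itself a relation, so it witnesses [Q j] wherever it is positive. *)
have Vout j : j \in F -> j \notin G -> V j = 0.
  move=> jF jG; apply/eqP; rewrite eq_le V0 andbT leNgt; apply/negP => Vj.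
  by move/negP: jG; apply; apply/GP; split=> //; exists V.
have sG (B : lmodType R) (h : label A -> B) :
    \sum_(j in F) V j *: h j = \sum_(j in G) V j *: h j.
  rewrite (bigID (mem G)) /= [X in _ + X]big1 => [|j /andP[jF jG]]; last first.
    by rewrite Vout // scale0r.
  rewrite addr0; apply: eq_bigl => j.
  by apply: andb_idl => /GP[].
rewrite sG in Vz.
have T1 : 1 <= \sum_(j in G) V j.
  have -> : \sum_(j in G) V j = \sum_(j in F) V j.
    have := sG R^o (fun=> 1) => /esym.
    by rewrite /GRing.scale /=; under eq_bigr do rewrite mulr1;
       under [in RHS]eq_bigr do rewrite mulr1.
  rewrite -w01; apply: ler_sum => j jF; rewrite /V jF lerDl.
  by apply: sumr_ge0 => i _; case: (WP i).
have T0 : 0 < \sum_(j in G) V j by apply: lt_le_trans T1.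
set T := \sum_(j in G) V j in T0 T1.
exists (fun j => V j / T); split.
- by move=> i /VG h; rewrite divr_gt0.
- by rewrite -mulr_suml divff // gt_eqF.
have : T *: r = \sum_(j in G) V j *: pt j.
  apply/esym/eqP; rewrite -subr_eq0 /T scaler_suml -sumrB; apply/eqP.
  by apply: etrans Vz; apply: eq_bigr => i _; rewrite scalerBr.
move/(congr1 (fun x => T^-1 *: x)); rewrite scalerA mulVf ?gt_eqF // scale1r => ->.
by rewrite scaler_sumr; apply: eq_bigr => i _; rewrite scalerA mulrC.
Qed.

End Hulls.

(** * Relative interiors *)

Lemma norm_entry_le (R : realType) (m n : nat) (x : 'M[R]_(m, n)) i j :
  `|x i j| <= `|x|.
Proof.
rewrite [leRHS]/Num.Def.normr /= mx_normrE.
by apply/bigmax_geP; right => /=; exists (i, j).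
Qed.

(* A pseudo-inverse of the matrix of generators gives preimages that depend
   linearly, hence continuously, on their target. *)
Lemma small_preimage (R : realType) (m n : nat) (P : 'M[R]_(m, n)) (eta : R) :
  0 < eta -> exists2 e : R, 0 < e & forall x : 'rV[R]_n, (x <= P)%MS ->
    `|x| < e -> exists2 g : 'rV[R]_m, x = g *m P & forall k, `|g 0 k| <= eta.
Proof.
move=> eta0; pose N := pinvmx P.
pose K := 1 + \sum_j \sum_k `|N j k|.
have K0 : 0 < K.
  by rewrite ltr_pwDl //; apply: sumr_ge0 => j _; apply: sumr_ge0.
exists (eta / K); first exact: divr_gt0.
move=> x xP xe; exists (x *m N); first by rewrite mulmxKpV.
move=> k; rewrite mxE; apply: le_trans (ler_norm_sum _ _ _) _.
apply: le_trans (_ : eta / K * K <= _); last by rewrite divfK ?gt_eqF.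
rewrite {2}/K mulrDr mulr1 mulr_sumr.
apply: le_trans (_ : \sum_j eta / K * \sum_k `|N j k| <= _); last first.
  by rewrite lerDr divr_ge0 ?ltW.
apply: ler_sum => j _; rewrite normrM; apply: ler_pM => //.
  exact: le_trans (norm_entry_le _ _ _) (ltW xe).
by rewrite (bigD1 k) //= lerDl sumr_ge0.
Qed.

Section RelativeInterior.
Context {R : realType} {d : nat} {A : pointConfig R d}.
Implicit Types (F G H : {set label A}) (r x y v c : 'rV[R]_d).

(** Push [r] away from a strict point [q] to a point [y] still in the hull; [r] is then a mixture of
    [q] and [y] with positive weight on [q]. *)
Lemma strict_hull_of_relint F r : relint (hull F) r -> strict_hull F r.
Proof.
move=> [Fr /nbhs_normP[e /= e0 He]].
have [q Fq] := strict_hull_bary (hull_neq0 Fr).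
have k0 : 0 < `|r - q| + 1 by rewrite ltr_wpDl.
pose t := e / 2 / (`|r - q| + 1).
have t0 : 0 < t by rewrite !divr_gt0.
have t1 : 0 < 1 + t by rewrite addr_gt0.
pose y := r + t *: (r - q).
have Fy : hull F y.
  apply: He => /=.
    rewrite /y opprD addNKr normrN normrZ gtr0_norm //.
    apply: le_lt_trans (_ : t * (`|r - q| + 1) < _).
      by rewrite ler_wpM2l ?lerDl // ltW.
    by rewrite /t divfK ?gt_eqF // ltr_pdivrMr // ltr_pMr // ltr1n.
  exists 2%N, (fun i => if i == 0 then r else q),
    (fun i => if i == 0 then 1 + t else - t); split.
  - by move=> i; case: ifP => // _; apply: strict_hullW.
  - by rewrite big_ord_recl big_ord1 /= addrK.
  rewrite big_ord_recl big_ord1 /= /y scalerBr scalerDl scale1r scaleNr.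
  by rewrite addrA.
have -> : r = (t / (1 + t)) *: q + (1 - t / (1 + t)) *: y.
  by apply/rowP => k; rewrite /y !mxE; field; rewrite gt_eqF.
apply: strict_hull_mix => //.
by rewrite divr_gt0 //= ler_pdivrMr // mul1r lerDr.
Qed.

(** If [y - r] has small coefficients [gg], of sum [s], on the vectors [pt i - r], then [y] has
    weights [gg i + (1 - s) * w i]. *)
Lemma relint_of_strict_hull F r : strict_hull F r -> relint (hull F) r.
Proof.
move=> Fr; split; first exact: strict_hullW.
have [w [w0 w1 rE]] := Fr.
have [e0 e00 He0] := @small_step R (label A) (mem F) w (fun=> -1) w0.
pose m := #|label A|.
(* The second bound gives [s] at most 1/2, so at least half of [w i] survives; the first keeps
   [gg i] from cancelling that half. The successor makes [eta] positive whatever [m] is. *)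
pose eta := Num.min (e0 / 2) (2 * (m.+1)%:R)^-1.
have m0 : 0 < (m.+1)%:R :> R by rewrite ltr0n.
have eta0 : 0 < eta by rewrite lt_min divr_gt0 //= invr_gt0 mulr_gt0.
pose P := \matrix_(k < m) (if enum_val k \in F then pt (enum_val k) - r else 0).
have PE (g : 'rV[R]_m) :
    g *m P = \sum_(i in F) g 0 (enum_rank i) *: (pt i - r).
  rewrite mulmx_sum_row [RHS](reindex _ (onW_bij _ (@enum_val_bij (label A)))).
  rewrite [RHS]big_mkcond /=; apply: eq_bigr => k _; rewrite rowK enum_valK.
  by case: ifP => // _; rewrite scaler0.
have [e ep He] := small_preimage P eta0.
apply/nbhs_normP; exists e => //= y /= ye /affhull_hull[a [a1 yE]].
have yrE : y - r = (\row_k a (enum_val k)) *m P.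
  rewrite PE; under eq_bigr => i _ do rewrite mxE enum_rankK scalerBr.
  by rewrite sumrB -yE -scaler_suml a1 scale1r.
have [||g yg gle] := He (y - r).
- by rewrite yrE submxMl.
- by rewrite distrC.
pose gg i := g 0 (enum_rank i); pose s := \sum_(i in F) gg i.
rewrite PE -/gg in yg.
have sle : s <= 1 / 2.
  apply: le_trans (_ : \sum_(i in F) eta <= _).
    by apply: ler_sum => i _; apply: le_trans (ler_norm _) (gle _).
  rewrite sumr_const; apply: le_trans (_ : eta *+ m.+1 <= _).
    rewrite -[leLHS]mulr_natr -[leRHS]mulr_natr ler_pM2l // ler_nat.
    by rewrite ltnW // ltnS max_card.
  rewrite -(mulr_natr eta); apply: le_trans (_ : (2 * (m.+1)%:R)^-1 * (m.+1)%:R <= _).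
    by rewrite ler_wpM2r ?(ltW m0) // ge_min lexx orbT.
  by rewrite invfM -mulrA mulVf ?gt_eqF // mulr1 div1r.
apply/hullP; exists (fun i => gg i + (1 - s) * w i); split.
- move=> i iF; have := gle (enum_rank i); rewrite ler_norml => /andP[h _].
  have h1 : eta <= e0 / 2 by rewrite ge_min lexx.
  have h2 : 0 < w i + e0 * -1 by apply: He0 => //; rewrite lexx ltW.
  have h3 : 1 / 2 * w i <= (1 - s) * w i by rewrite ler_pM2r ?w0 //; lra.
  rewrite /gg; lra.
- by rewrite big_split /= -mulr_sumr w1 mulr1 -/s addrC subrK.
under eq_bigr => i _ do rewrite scalerDl -scalerA.
rewrite big_split /= -scaler_sumr -rE scalerBl scale1r.
have : y - r = \sum_(i in F) gg i *: pt i - s *: r.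
  rewrite yg; under eq_bigr => i _ do rewrite scalerBr.
  by rewrite sumrB -scaler_suml.
by move/eqP; rewrite subr_eq => /eqP ->; rewrite -addrA [- _ + _]addrC.
Qed.

Lemma relintP F r : relint (hull F) r <-> strict_hull F r.
Proof. by split; [apply: strict_hull_of_relint|apply: relint_of_strict_hull]. Qed.

Lemma sum_setT (V : nmodType) (h : label A -> V) :
  \sum_(i in [set: label A]%SET) h i = \sum_i h i.
Proof. by apply: eq_bigl => i; rewrite finset.in_setT. Qed.

Lemma affine_weights x : exists w : label A -> R,
  \sum_i w i = 1 /\ x = \sum_i w i *: pt i.
Proof.
have : affhull (range (@pt R d A)) x by rewrite pt_span.
case=> k [v [w [vF w1 ->]]].
have /choice[j jP] : forall i, exists l : label A, pt l = v i.
  by move=> i; have [l _ <-] := vF i; exists l.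
exists (fun l => \sum_(i | j i == l) w i); split.
  by rewrite -w1 -(regroup_weights w (fun i => finset.in_setT (j i))) sum_setT.
rewrite -(sum_setT (fun i => (\sum_(i0 | j i0 == i) w i0) *: pt i)).
rewrite -regroup_sum => [|i]; last exact: finset.in_setT.
by apply: eq_bigr => i _; rewrite jP.
Qed.

Lemma affhull_hullT : affhull (hull [set: label A]%SET) = setT.
Proof.
apply/seteqP; split=> // x _; have [w [w1 ->]] := affine_weights x.
exists #|label A|, (fun k => pt (enum_val k)), (fun k => w (enum_val k)); split.
- by move=> k; apply: hull_pt; rewrite finset.in_setT.
- by rewrite -w1 [RHS](reindex _ (onW_bij _ (@enum_val_bij (label A)))).
- by rewrite [LHS](reindex _ (onW_bij _ (@enum_val_bij (label A)))).
Qed.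

(** By [pt_span] the affine hull is the whole space, so interior and relative interior agree. *)
Lemma interior_hullT r :
  interior (hull [set: label A]%SET) r <-> strict_hull [set: label A]%SET r.
Proof.
rewrite -relintP; split=> [h|[_ h]].
  split; first exact: interior_subset.
  by apply: filterS h => y.
by apply: filterS h => y; apply; rewrite affhull_hullT.
Qed.

Lemma interior_faceP (S : {set {set label A}}) F : interior_face S F <->
  F \in S /\ exists2 r, hull F r & strict_hull [set: label A]%SET r.
Proof.
split=> -[FS h]; split=> //.
  apply: contrapT => nh; apply: h => r Fr; split.
    by apply: subset_closure; apply: hullS Fr; apply: finset.subsetT.
  by move/interior_hullT => hr; apply: nh; exists r.
by case: h => r Fr /interior_hullT hr /(_ r Fr)[].
Qed.

End RelativeInterior.

Section SubdivisionFacts.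
Context {R : realType} {d : nat} {A : pointConfig R d}.
Context (S : {set {set label A}}) (subS : subdivision S).
Implicit Types (F G H K : {set label A}) (r x y v c : 'rV[R]_d).

Lemma subdivision_face F G : F \in S -> face F G -> G \in S.
Proof. by case: subS => h _ _; apply: h. Qed.

Lemma subdivision_uniq F G r : F \in S -> G \in S ->
  strict_hull F r -> strict_hull G r -> F = G.
Proof.
case: subS => _ _ h FS GS /relintP Fr /relintP Gr; apply: contrapT => nFG.
by have := h F G FS GS nFG => /seteqP[/(_ r)] + _; apply.
Qed.

Lemma subdivision_carrier r : hull [set: label A]%SET r ->
  exists2 K, K \in S & strict_hull K r.
Proof.
case: (subS) => _ <- _ [F /= FS Fr]; have [G FG Gr] := carrier Fr.
by exists G => //; apply: subdivision_face FG.
Qed.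

End SubdivisionFacts.

(** * The fan of a subdivision around a minimal interior face *)

Section Fan.
Context {R : realType} {d : nat} {A : pointConfig R d}.
Context (S : {set {set label A}}) (subS : subdivision S).
Context (F0 : {set label A}) (intF0 : interior_face S F0).
Context (minF0 : forall F, interior_face S F -> F0 \subset F).
Context (p0 : 'rV[R]_d) (F0p0 : strict_hull F0 p0).
Implicit Types (F G H K : {set label A}) (r x y v c l : 'rV[R]_d).

Definition vec (i : label A) : 'rV[R]_d := pt i - p0.

Definition cone F v : Prop := exists w : label A -> R,
  (forall i, i \in F -> 0 <= w i) /\ v = \sum_(i in F) w i *: vec i.

Definition open_cone F v : Prop := exists w : label A -> R,
  (forall i, i \in F -> 0 < w i) /\ v = \sum_(i in F) w i *: vec i.

Lemma open_coneW F v : open_cone F v -> cone F v.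
Proof. by case=> w [w0 e]; exists w; split=> // i /w0/ltW. Qed.

Lemma cone_vec F i : i \in F -> cone F (vec i).
Proof.
move=> iF; exists (fun j => (j == i)%:R); split=> [j _|]; first exact: ler0n.
rewrite (bigD1 i) //= eqxx scale1r big1 ?addr0 // => j /andP[_ /negPf->].
exact: scale0r.
Qed.

Lemma cone0 F : cone F 0.
Proof. by exists (fun=> 0); split=> //; rewrite big1 // => i _; rewrite scale0r. Qed.

Lemma coneD F x y : cone F x -> cone F y -> cone F (x + y).
Proof.
move=> [w [w0 ->]] [w' [w'0 ->]]; exists (fun i => w i + w' i); split.
  by move=> i iF; rewrite addr_ge0 ?w0 ?w'0.
by rewrite -big_split; apply: eq_bigr => i _; rewrite scalerDl.
Qed.

Lemma coneZ F (a : R) x : 0 <= a -> cone F x -> cone F (a *: x).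
Proof.
move=> a0 [w [w0 ->]]; exists (fun i => a * w i); split=> [i iF|].
  by rewrite mulr_ge0 ?w0.
by rewrite scaler_sumr; apply: eq_bigr => i _; rewrite scalerA.
Qed.

Lemma cone_sum F (J : finType) (P : pred J) (t : J -> R) (u : J -> 'rV[R]_d) :
  (forall j, P j -> 0 <= t j) -> (forall j, P j -> cone F (u j)) ->
  cone F (\sum_(j | P j) t j *: u j).
Proof.
move=> t0 Fu; apply: (big_ind (cone F)); [exact: cone0|exact: coneD|].
by move=> j Pj; apply: coneZ; [apply: t0|apply: Fu].
Qed.

Lemma coneS F G v : F \subset G -> cone F v -> cone G v.
Proof.
move=> /fintype.subsetP FG [w [w0 ->]]; apply: cone_sum => i iF; first exact: w0.
exact/cone_vec/FG.
Qed.

Lemma dot_cone_le0 F c v : (forall i, i \in F -> dot c (vec i) <= 0) ->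
  cone F v -> dot c v <= 0.
Proof.
move=> c0 [w [w0 ->]]; rewrite dot_sumr; apply: sumr_le0 => i iF.
by rewrite mulr_ge0_le0 ?w0 ?c0.
Qed.

Lemma dot_open_cone_lt0 F c v i : (forall i, i \in F -> dot c (vec i) <= 0) ->
  open_cone F v -> i \in F -> dot c (vec i) < 0 -> dot c v < 0.
Proof.
move=> c0 [w [w0 ->]] iF ci; rewrite dot_sumr (bigD1 i) //=.
apply: ltr_nwDl; first by rewrite nmulr_llt0 ?w0.
by apply: sumr_le0 => j /andP[jF _]; rewrite mulr_ge0_le0 ?c0 // ltW ?w0.
Qed.

Lemma dot_open_cone_eq0 F c v : (forall i, i \in F -> dot c (vec i) <= 0) ->
  open_cone F v -> dot c v = 0 -> forall i, i \in F -> dot c (vec i) = 0.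
Proof.
move=> c0 Fv e i iF; apply/eqP; rewrite eq_le c0 //= leNgt; apply/negP => ci.
by have := dot_open_cone_lt0 c0 Fv iF ci; rewrite e ltxx.
Qed.

Lemma hull_p0 F : F0 \subset F -> hull F p0.
Proof. by move=> h; apply: hullS h _; apply: strict_hullW. Qed.

(** Only some point [q] of [hull F0] is known to be interior. As [p0] has positive weights on [F0],
    it is a mixture of [q], with positive weight, and another point of that hull. *)
Lemma interiorT_p0 : strict_hull [set: label A]%SET p0.
Proof.
have [_ [q F0q Tq]] := (interior_faceP _ _).1 intF0.
have [w [w0 w1 p0E]] := F0p0; have [w' [w'0 w'1 qE]] := (hullP _ _).1 F0q.
have [e e0 He] := @small_step R (label A) (mem F0) w (fun i => - w' i) w0.
pose t := Num.min e (1 / 2).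
have t0 : 0 < t by rewrite lt_min e0 divr_gt0.
have t1 : t < 1 by rewrite gt_min ltr_pdivrMr // mul1r ltr1n orbT.
have t1' : 1 - t != 0 by rewrite subr_eq0 gt_eqF.
have -> : p0 = t *: q + (1 - t) *: ((1 - t)^-1 *: (p0 - t *: q)).
  by rewrite scalerA divff // scale1r addrC subrK.
apply: strict_hull_mix => //; first by rewrite t0 ltW.
apply: (@hullS _ _ _ F0); first exact: finset.subsetT.
apply/hullP; exists (fun i => (1 - t)^-1 * (w i - t * w' i)); split.
- move=> i iF; rewrite mulr_ge0 // ?invr_ge0 ?subr_ge0 ?(ltW t1) //.
  have := He t; rewrite ltW //= ge_min lexx => /(_ isT i iF).
  by rewrite mulrN subr_gt0 => /ltW.
- by rewrite -mulr_sumr sumrB -mulr_sumr w1 w'1 mulr1 mulVf.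
rewrite [in LHS]p0E [in LHS]qE scaler_sumr -sumrB scaler_sumr.
by apply: eq_bigr => i _; rewrite scalerA -scalerBl scalerA.
Qed.

Lemma interior_face_sup K : K \in S -> F0 \subset K -> interior_face S K.
Proof.
move=> KS F0K; apply/interior_faceP; split=> //.
by exists p0; [apply: hull_p0|apply: interiorT_p0].
Qed.

Lemma F0_relation : exists w : label A -> R,
  [/\ forall i, i \in F0 -> 0 < w i, \sum_(i in F0) w i = 1 &
    \sum_(i in F0) w i *: vec i = 0].
Proof.
have [w [w0 w1 e]] := F0p0; exists w; split=> //.
under eq_bigr => i _ do rewrite scalerBr.
by rewrite sumrB -e -scaler_suml w1 scale1r subrr.
Qed.

(** Turns a conic combination into an affine one: the missing mass [a - W] is put on the relation of
    [F0], which has sum 1 and contributes no displacement. *)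
Lemma cone_weights F (w : label A -> R) (a : R) : F0 \subset F ->
  \sum_(i in F) w i <= a -> 0 < a -> exists w' : label A -> R,
  [/\ forall i, i \in F -> a^-1 * w i <= w' i, \sum_(i in F) w' i = 1 &
    p0 + a^-1 *: (\sum_(i in F) w i *: vec i) = \sum_(i in F) w' i *: pt i].
Proof.
move=> F0F wa a0; have [b [b0 b1 be]] := F0_relation.
pose W := \sum_(i in F) w i.
pose bb i := if i \in F0 then b i else 0.
have bbS (V : lmodType R) (h : label A -> V) :
    \sum_(i in F) bb i *: h i = \sum_(i in F0) b i *: h i.
  rewrite (bigID (mem F0)) /= [X in _ + X]big1 => [|i /andP[_ /negPf iF]].
    rewrite addr0; apply: eq_big => [i|i /andP[_ iF]]; last by rewrite /bb iF.
    by apply/andb_idl/(fintype.subsetP F0F).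
  by rewrite /bb iF scale0r.
have bb1 : \sum_(i in F) bb i = 1.
  rewrite -b1 big_mkcond [RHS]big_mkcond; apply: eq_bigr => i _ /=.
  rewrite /bb; case: ifP => // /negP iF; case: ifP => // iF0.
  by case: iF; apply: (fintype.subsetP F0F).
have sum1 : \sum_(i in F) a^-1 * (w i + (a - W) * bb i) = 1.
  rewrite -mulr_sumr big_split /= -mulr_sumr bb1 mulr1 -/W addrC subrK.
  by rewrite mulVf ?gt_eqF.
exists (fun i => a^-1 * (w i + (a - W) * bb i)); split=> //.
- move=> i iF; rewrite ler_pM2l ?invr_gt0 // lerDl mulr_ge0 ?subr_ge0 //.
  by rewrite /bb; case: ifP => // /b0/ltW.
have -> : \sum_(i in F) w i *: vec i =
    \sum_(i in F) (w i + (a - W) * bb i) *: vec i.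
  under [RHS]eq_bigr => i _ do rewrite scalerDl -scalerA.
  by rewrite big_split /= -scaler_sumr bbS be scaler0 addr0.
rewrite scaler_sumr; under eq_bigr => i _ do rewrite scalerA scalerBr.
by rewrite sumrB -scaler_suml sum1 scale1r addrC subrK.
Qed.

(** All scales beyond [a] are allowed, so that the result can be combined with [interiorT_point] at
    a common scale. *)
Lemma cone_point F v : F0 \subset F -> cone F v ->
  exists2 a : R, 0 < a & forall a', a <= a' -> hull F (p0 + a'^-1 *: v).
Proof.
move=> F0F [w [w0 ->]]; exists (1 + \sum_(i in F) w i).
  by rewrite ltr_pwDl // sumr_ge0.
move=> a' ha; have s0 : 0 <= \sum_(i in F) w i by apply: sumr_ge0 => i /w0.
have [||w' [w'0 w'1 ->]] := @cone_weights F w a' F0F; [lra|lra|].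
apply/hullP; exists w'; split=> // i iF; apply: le_trans (w'0 i iF).
by rewrite mulr_ge0 ?w0 // invr_ge0; lra.
Qed.

Lemma open_cone_point F v : F0 \subset F -> open_cone F v ->
  exists2 a : R, 0 < a & forall a', a <= a' -> strict_hull F (p0 + a'^-1 *: v).
Proof.
move=> F0F [w [w0 ->]].
have s0 : 0 <= \sum_(i in F) w i by apply: sumr_ge0 => i /w0/ltW.
exists (1 + \sum_(i in F) w i); first by rewrite ltr_pwDl.
move=> a' ha.
have [||w' [w'0 w'1 ->]] := @cone_weights F w a' F0F; [lra|lra|].
exists w'; split=> // i iF; apply: lt_le_trans (w'0 i iF).
by rewrite mulr_gt0 ?w0 // invr_gt0; lra.
Qed.

Lemma interiorT_point v : exists2 a : R, 0 < a &
  forall a', a <= a' -> strict_hull [set: label A]%SET (p0 + a'^-1 *: v).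
Proof.
have [w [w0 w1 p0E]] := interiorT_p0.
have [g [g1 gE]] := affine_weights (A := A) (p0 + v).
have [e e0 He] := @small_step R (label A) xpredT w (fun i => g i - w i)
  (fun i _ => w0 i (finset.in_setT i)).
exists e^-1 => [|a' ha]; first by rewrite invr_gt0.
have a0 : 0 < a' by apply: lt_le_trans ha; rewrite invr_gt0.
exists (fun i => w i + a'^-1 * (g i - w i)); split.
- by move=> i _; apply: He => //; rewrite invr_ge0 (ltW a0) invf_ple ?posrE.
- rewrite big_split /= -mulr_sumr sumrB w1.
  by rewrite sum_setT g1 subrr mulr0 addr0.
under eq_bigr => i _ do rewrite scalerDl -scalerA scalerBl.
rewrite big_split /= -scaler_sumr sumrB -p0E sum_setT -gE.
by rewrite [p0 + v]addrC addrK.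
Qed.

Lemma open_cone_strict F r (a : R) v : 0 < a -> strict_hull F r -> r = p0 + a *: v ->
  open_cone F v.
Proof.
move=> a0 [w [w0 w1 ->]] e; exists (fun i => a^-1 * w i); split=> [i iF|].
  by rewrite mulr_gt0 ?invr_gt0 ?w0.
under eq_bigr => i _ do rewrite -scalerA scalerBr scalerBr.
rewrite sumrB -scaler_sumr e -scaler_sumr -scaler_suml w1 scale1r -scalerBr.
by rewrite addrC addKr scalerA mulVf ?gt_eqF // scale1r.
Qed.

Lemma interior_face_strict K r : K \in S -> strict_hull K r ->
  strict_hull [set: label A]%SET r -> interior_face S K.
Proof.
by move=> KS Kr Tr; apply/interior_faceP; split=> //; exists r => //; apply: strict_hullW.
Qed.

Lemma fan_complete v : exists2 K, interior_face S K & open_cone K v.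
Proof.
have [a a0 Ha] := interiorT_point v; have Tr := Ha a (lexx a).
have [K KS Kr] := subdivision_carrier subS (strict_hullW Tr).
exists K; first exact: interior_face_strict Kr Tr.
by apply: open_cone_strict Kr erefl; rewrite invr_gt0.
Qed.

Lemma fan_uniq F G v : interior_face S F -> interior_face S G ->
  open_cone F v -> open_cone G v -> F = G.
Proof.
move=> iF iG Fv Gv.
have [a a0 Ha] := open_cone_point (minF0 iF) Fv.
have [b b0 Hb] := open_cone_point (minF0 iG) Gv.
apply: (subdivision_uniq subS iF.1 iG.1 (Ha (Num.max a b) _) (Hb (Num.max a b) _)).
  by rewrite le_max lexx.
by rewrite le_max lexx orbT.
Qed.

(** [K] is the carrier in [H] of a point [p0 + m^-1 *: v]. Since [p0] lies in [hull K], the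
    functional exposing [K] takes its bound at [p0] and so becomes homogeneous on the vectors
    [vec i]. *)
Lemma fan_carrier H v : interior_face S H -> cone H v -> exists K c,
  [/\ interior_face S K, K \subset H, open_cone K v,
      forall i, i \in H -> dot c (vec i) <= 0 &
      forall i, i \in H -> (i \in K <-> dot c (vec i) = 0)].
Proof.
move=> iH Hv; have [a a0 Ha] := cone_point (minF0 iH) Hv.
have [b b0 Hb] := interiorT_point v.
pose m := Num.max a b.
have Hr := Ha m; have Tr := Hb m; rewrite !le_max !lexx orbT in Hr Tr.
have {}Hr := Hr isT; have {}Tr := Tr isT.
have m0 : 0 < m by rewrite lt_max a0.
have [K HK Kr] := carrier Hr.
have KS : K \in S by apply: subdivision_face HK; case: iH.
have iK := interior_face_strict KS Kr Tr.
have /faceP[c [q [cq KP]]] := HK.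
have cp0 : dot c p0 = q.
  apply/le_anti/andP; split.
    by apply: (dot_hull_le _ (hull_p0 (minF0 iK))) => i /KP[_ ->].
  rewrite -lerN2 -dotNl; apply: (dot_hull_le _ (hull_p0 (minF0 iK))) => i.
  by move=> /KP[_ e]; rewrite dotNl e.
exists K, c; split=> //.
- exact: face_sub.
- by apply: open_cone_strict Kr erefl; rewrite invr_gt0.
- by move=> i iiH; rewrite /vec dotBr cp0 subr_le0 cq.
move=> i iiH; rewrite KP /vec dotBr cp0; split=> [[_ ->]|/subr0_eq]; last by [].
by rewrite subrr.
Qed.

(** Controls labels that are no vertices: [K] is a face of [H], and a face contains every label of
    [H] on its hyperplane. *)
Lemma fan_mem H i K : interior_face S H -> i \in H ->
  interior_face S K -> open_cone K (vec i) -> i \in K.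
Proof.
move=> iH iiH iK Kv.
have [K' [c [iK' K'H K'v c0 cK']]] := fan_carrier iH (cone_vec iiH).
rewrite (fan_uniq iK iK' Kv K'v); apply/cK' => //.
have [w [w0 e]] := K'v; rewrite e dot_sumr big1 // => j jK.
by rewrite (cK' j (fintype.subsetP K'H j jK)).1 ?mulr0.
Qed.

Lemma cone_F0_open l : cone F0 l -> open_cone F0 l.
Proof.
move=> [w [w0 ->]]; have [b [b0 _ be]] := F0_relation.
exists (fun i => w i + b i); split=> [i iF|]; first by rewrite ltr_wpDl ?w0 ?b0.
under [RHS]eq_bigr => i _ do rewrite scalerDl.
by rewrite big_split /= be addr0.
Qed.

(** Subtracting a small multiple of [w] from the positive relation [b] leaves nonnegative weights.
    Thus [cone F0] is a linear space. *)
Lemma cone_F0N l : cone F0 l -> cone F0 (- l).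
Proof.
move=> [w [w0 ->]]; have [b [b0 b1 be]] := F0_relation.
have [e e0 He] := @small_step R (label A) (mem F0) b (fun i => - w i) b0.
have ei0 : 0 < e^-1 by rewrite invr_gt0.
have -> : - (\sum_(i in F0) w i *: vec i) =
    e^-1 *: \sum_(i in F0) (b i + e * - w i) *: vec i.
  under [in RHS]eq_bigr => i _ do rewrite scalerDl -scalerA scaleNr.
  rewrite big_split /= be add0r -scaler_sumr scalerA mulVf ?gt_eqF // scale1r.
  by rewrite sumrN.
apply: coneZ; first exact: ltW.
by eexists; split; last reflexivity; move=> i iF; apply/ltW/He; rewrite // lexx ltW.
Qed.

Lemma dot_cone_F0 c l : (forall i, i \in F0 -> dot c (vec i) <= 0) ->
  cone F0 l -> dot c l = 0.
Proof.
move=> c0 Ll; apply/le_anti; rewrite (dot_cone_le0 c0 Ll) /=.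
by rewrite -oppr_le0 -dotNr (dot_cone_le0 c0 (cone_F0N Ll)).
Qed.

(** The case of the zero vector, whose open cone is that of [F0]. *)
Lemma carrier_F0 H : interior_face S H -> exists c,
  (forall i, i \in H -> dot c (vec i) <= 0) /\
  (forall i, i \in H -> (i \in F0 <-> dot c (vec i) = 0)).
Proof.
move=> iH; have [K [c [iK KH K0 c0 cK]]] := fan_carrier iH (cone0 H).
exists c; split=> //.
by rewrite (fan_uniq intF0 iK (cone_F0_open (cone0 F0)) K0).
Qed.

(** Slide a strict point [r] of [F] towards [p0]: the points passed are interior and all belong to
    the cell [K] whose open cone contains [r - p0]. In the limit [r] lies in [hull K], which makes
    [F] a face of [K]. *)
Lemma interior_cover F : F \in S -> exists2 K, interior_face S K & F \subset K.
Proof.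
move=> FS; have [->|Fn0] := eqVneq F finset.set0.
  by exists F0 => //; apply: finset.sub0set.
have [r Fr] := strict_hull_bary Fn0.
have Tr : hull [set: label A]%SET r.
  by apply: hullS (strict_hullW Fr); apply: finset.subsetT.
have [K iK Kv] := fan_complete (r - p0).
have Kt t : 0 < t < 1 -> hull K (p0 + t *: (r - p0)).
  case/andP=> t0 t1.
  have rE : p0 + t *: (r - p0) = (1 - t) *: p0 + (1 - (1 - t)) *: r.
    by apply/rowP => k; rewrite !mxE; ring.
  have Trt : strict_hull [set: label A]%SET (p0 + t *: (r - p0)).
    rewrite rE; apply: strict_hull_mix => //; last exact: interiorT_p0.
    by apply/andP; split; lra.
  have [K' K'S K'r] := subdivision_carrier subS (strict_hullW Trt).
  have iK' := interior_face_strict K'S K'r Trt.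
  have K'v := open_cone_strict t0 K'r erefl.
  by rewrite (fan_uniq iK iK' Kv K'v); apply: strict_hullW.
have Kr : hull K r.
  (* The limit is taken by Farkas on homogenised points: a functional separating [r] would be affine
     on the segment, nonnegative before its end and negative there. *)
  pose g i : 'rV[R]_(d + 1) := if i \in K then row_mx (pt i) 1 else 0.
  have dotrow (c : 'rV[R]_(d + 1)) x :
      dot c (row_mx x 1) = dot (lsubmx c) x + c 0 (rshift d ord0).
    rewrite /dot big_split_ord big_ord1 /= row_mxEr mxE eqxx mulr1; congr (_ + _).
    by apply: eq_bigr => j _; rewrite row_mxEl mxE.
  have [[w w0 e]|[c cg]] := farkas g (row_mx r 1).
    have eK : \sum_i w i *: g i =
        row_mx (\sum_(i in K) w i *: pt i) (\sum_(i in K) w i *: 1).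
      rewrite [in RHS]big_mkcond [X in row_mx _ X]big_mkcond /=.
      elim/big_rec3: _ => [|i x y z _ ->]; first by rewrite row_mx0.
      rewrite /g; case: ifP => _; last by rewrite scaler0 !add0r.
      by rewrite scale_row_mx add_row_mx.
    move: e; rewrite eK => /eq_row_mx[re /(congr1 (fun M : 'M_1 => M 0 0))].
    rewrite summxE; under eq_bigr do rewrite !mxE eqxx mulr1.
    rewrite mxE eqxx => w1.
    by apply/hullP; exists w; split.
  rewrite dotrow => cr.
  have ct t : 0 < t < 1 ->
      0 <= dot (lsubmx c) (p0 + t *: (r - p0)) + c 0 (rshift d ord0).
    move=> /Kt hK; suff : dot (- lsubmx c) (p0 + t *: (r - p0)) <= c 0 (rshift d ord0).
      by rewrite dotNl; lra.
    apply: (dot_hull_le _ hK) => i iK'.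
    by have := cg i; rewrite /g iK' dotrow dotNl; lra.
  move: ct cr; set q := c 0 _; set c1 := lsubmx c => ct cr.
  pose f0 := dot c1 p0 + q; pose f1 := dot c1 r + q.
  have fE t : dot c1 (p0 + t *: (r - p0)) + q = (1 - t) * f0 + t * f1.
    by rewrite dotDr dotZr dotBr /f0 /f1; ring.
  have f10 : f1 < 0 by [].
  have [f00|f00] := leP f0 0.
    have := ct (1 / 2); rewrite fE => h.
    have : 0 <= (1 - 1 / 2) * f0 + 1 / 2 * f1 by apply: h; lra.
    by lra.
  have k0 : 0 < f0 - f1 by lra.
  pose s := f0 / (f0 - f1).
  have s0 : 0 < s by rewrite divr_gt0.
  have s1 : s < 1 by rewrite ltr_pdivrMr //; lra.
  have fs : (1 - s) * f0 + s * f1 = 0 by rewrite /s; field; rewrite gt_eqF.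
  (* Any parameter strictly between the zero [s] and 1 gives the contradiction. *)
  pose t := (1 + s) / 2.
  have : 0 <= (1 - t) * f0 + t * f1.
    by rewrite -fE; apply: ct; rewrite /t; lra.
  have -> : (1 - t) * f0 + t * f1 = ((1 - s) * f0 + s * f1) / 2 + f1 / 2.
    by rewrite /t; field.
  by rewrite fs; lra.
have [G KG Gr] := carrier Kr.
exists K => //.
rewrite (subdivision_uniq subS FS (subdivision_face subS iK.1 KG) Fr Gr).
exact: face_sub.
Qed.

(* Otherwise Farkas yields a functional [c], nonnegative on the [u j] and
   negative at [vec i]; tilting it by a functional exposing [F0] until it becomes
   nonnegative on [H] exposes a face larger than [F0] that contains no [B j]. *)
Lemma cone_generated (J : finType) (P : pred J) (B : J -> {set label A})
    (u : J -> 'rV[R]_d) H : interior_face S H ->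
  (forall j, P j -> [/\ interior_face S (B j), B j != F0, B j \subset H &
     open_cone (B j) (u j)]) ->
  (forall K, interior_face S K -> K \subset H -> K != F0 ->
     exists2 j, P j & B j \subset K) ->
  forall i, i \in H -> exists (t : J -> R) l,
    [/\ forall j, 0 <= t j, cone F0 l & vec i = l + \sum_(j | P j) t j *: u j].
Proof.
move=> iH BP atom i iiH.
pose g (k : label A + J) : 'rV[R]_d := match k with
  | inl i => if i \in F0 then vec i else 0
  | inr j => if P j then u j else 0 end.
have [[w w0 e]|[c cg ci]] := farkas g (vec i).
  exists (fun j => w (inr j)), (\sum_(i in F0) w (inl i) *: vec i); split=> //.
    by exists (fun i => w (inl i)).
  rewrite e big_sumType /=; congr (_ + _); rewrite [RHS]big_mkcond;
    by apply: eq_bigr => k _; case: ifP; rewrite ?scaler0.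
have c0 k : k \in F0 -> dot (- c) (vec k) <= 0.
  by move=> kF; have := cg (inl k); rewrite /= kF dotNl oppr_le0.
have cF0 k : k \in F0 -> dot c (vec k) = 0.
  move=> kF; apply/eqP; rewrite -oppr_eq0 -dotNl; apply/eqP.
  exact: dot_cone_F0 c0 (cone_vec kF).
have [h [h0 hF0]] := carrier_F0 iH.
have F0H := fintype.subsetP (minF0 iH).
have hlt k : k \in H -> k \notin F0 -> dot h (vec k) < 0.
  move=> kH kF; rewrite lt_def h0 // andbT eq_sym; apply: contra kF => /eqP e.
  exact/(hF0 k kH).
(* As [h] is negative on [H] outside [F0], the largest ratio is the least tilt making [c']
   nonnegative on [H]; the label attaining it enters the exposed face. *)
pose ratio k := dot c (vec k) / dot h (vec k).
have iF0 : i \notin F0 by apply/negP => /cF0 e; rewrite e ltxx in ci.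
have Pi : (i \in H) && (i \notin F0) by rewrite iiH.
case: (@arg_maxP _ _ _ i (fun k => (k \in H) && (k \notin F0)) ratio Pi).
move=> m /andP[mH mF0] mmax; pose lam := ratio m.
have lam0 : 0 < lam.
  apply: lt_le_trans (mmax i Pi); rewrite /ratio -mulrNN -invrN.
  by rewrite divr_gt0 // oppr_gt0 // hlt.
pose c' := c - lam *: h.
have c'0 k : k \in H -> 0 <= dot c' (vec k).
  move=> kH; rewrite /c' dotBl dotZl; have [kF|kF] := boolP (k \in F0).
    by rewrite cF0 // (hF0 k kH).1 // mulr0 subr0.
  have := mmax k; rewrite kH kF => /(_ isT); rewrite -/lam /ratio => le.
  by rewrite subr_ge0 -ler_ndivrMr ?hlt.
pose K := [set k in H | dot c' (vec k) == 0]%SET.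
have HK : face H K.
  apply/faceP; exists (- c'), (- dot c' p0); split=> k.
    by move/c'0; rewrite /vec dotBr dotNl subr_ge0 lerN2.
  rewrite inE dotNl /vec dotBr subr_eq0; split=> [/andP[-> /eqP->]//|[-> /oppr_inj->]].
  by rewrite eqxx.
have KS : K \in S by apply: subdivision_face HK; case: iH.
have F0K : F0 \subset K.
  apply/fintype.subsetP => k kF; rewrite inE F0H //= /c' dotBl dotZl cF0 //.
  by rewrite (hF0 k (F0H k kF)).1 // mulr0 subr0.
have mK : m \in K.
  rewrite inE mH /= /c' dotBl dotZl /lam /ratio divfK ?subrr //.
  by rewrite lt_eqF ?hlt.
have KF0 : K != F0 by apply: contra mF0 => /eqP <-.
have [j Pj BK] := atom K (interior_face_sup KS F0K) (face_sub HK) KF0.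
have [iB BF0 BH Bu] := BP j Pj.
have : dot c' (u j) = 0.
  have [w [_ ->]] := Bu; rewrite dot_sumr big1 // => k kB.
  have := fintype.subsetP BK k kB; rewrite inE => /andP[_ /eqP ->].
  exact: mulr0.
have hu : dot h (u j) < 0.
  have [k kB kF] : exists2 k, k \in B j & k \notin F0.
    apply/subsetPn; apply: contra BF0 => BF.
    by rewrite finset.eqEsubset BF minF0.
  have kH := fintype.subsetP BH k kB.
  apply: (dot_open_cone_lt0 _ Bu kB); last exact: hlt.
  by move=> k' k'B; apply/h0/(fintype.subsetP BH).
have cu : 0 <= dot c (u j) by have := cg (inr j); rewrite /= Pj.
rewrite /c' dotBl dotZl => /eqP; rewrite subr_eq0 => /eqP e.
by move: cu; rewrite e pmulr_rge0 // leNgt hu.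
Qed.

End Fan.

(** * Linear algebra of a fan with the combinatorics of a bipyramid *)

(** Some column of [cokermx M] does not vanish on [z]; scaling it by that value fixes the sign. *)
Lemma sep_functional (R : realType) (m n : nat) (M : 'M[R]_(m, n)) (z : 'rV[R]_n) :
  ~~ (z <= M)%MS -> exists2 c : 'rV[R]_n,
    forall y : 'rV[R]_n, (y <= M)%MS -> dot c y = 0 & 0 < dot c z.
Proof.
move=> zM.
have [k zk] : exists k, (z *m cokermx M) 0 k != 0.
  apply/existsP; move: zM; apply: contraR; rewrite submxE => /existsPn h.
  by apply/eqP/rowP => k; rewrite [RHS]mxE; apply/eqP; move: (h k); rewrite negbK.
pose c0 : 'rV[R]_n := \row_j cokermx M j k.
have c0E y : dot c0 y = (y *m cokermx M) 0 k.
  by rewrite mxE; apply: eq_bigr => j _; rewrite mxE mulrC.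
have c0M (y : 'rV[R]_n) : (y <= M)%MS -> dot c0 y = 0.
  by rewrite submxE c0E => /eqP ->; rewrite mxE.
exists (dot c0 z *: c0) => [y /c0M e|]; first by rewrite dotZl e mulr0.
by rewrite dotZl -expr2 exprn_even_gt0 //= c0E.
Qed.

(* Vertices of the boundary of the triangular bipyramid: [inl] are the two
   apices, [inr] the three equatorial vertices; dually, the bottom, top and side
   facets of the prism. *)
Definition vtx : finType := (bool + 'I_3)%type.

(** The faces of the boundary, the empty one included: no edge joins the apices and the equator
    bounds no triangle. *)
Definition bip (J : {set vtx}) : bool :=
  ~~ ((inl true \in J) && (inl false \in J)) && [exists k, inr k \notin J].

Section BipyramidFan.
Context {R : realType} {d m : nat} (Lm : 'M[R]_(m, d)) (u : vtx -> 'rV[R]_d).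
Implicit Types (t q p : 'I_3 -> R) (s : bool).

Definition supp (t : vtx -> R) : {set vtx} := [set j | 0 < t j]%SET.

Context (bip_cover : forall v : 'rV[R]_d, exists t : vtx -> R,
  [/\ forall j, 0 <= t j, bip (supp t) & ((v - \sum_j t j *: u j)%R <= Lm)%MS]).
Context (bip_supp : forall t t' : vtx -> R,
  (forall j, 0 <= t j) -> (forall j, 0 <= t' j) -> bip (supp t) -> bip (supp t') ->
  ((\sum_j t j *: u j - \sum_j t' j *: u j)%R <= Lm)%MS -> supp t = supp t').

Let X q : 'rV[R]_d := \sum_k q k *: u (inr k).

Let XD q q' : X q + X q' = X (fun k => q k + q' k).
Proof. by rewrite /X -big_split; apply: eq_bigr => k _; rewrite scalerDl. Qed.

Let XZ (a : R) q : a *: X q = X (fun k => a * q k).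
Proof. by rewrite /X scaler_sumr; apply: eq_bigr => k _; rewrite scalerA. Qed.

Let eqX q q' : (forall k, q k = q' k) -> X q = X q'.
Proof. by move=> e; apply: eq_bigr => k _; rewrite e. Qed.

Let sumE (t : vtx -> R) : \sum_j t j *: u j =
  t (inl true) *: u (inl true) + t (inl false) *: u (inl false) +
  X (fun k => t (inr k)).
Proof. by rewrite big_sumType /= big_bool. Qed.

Let posp q k : R := Num.max (q k) 0.
Let negp q k : R := Num.max (- q k) 0.

Let posneg q : X q = X (posp q) - X (negp q).
Proof.
rewrite -scaleN1r XZ XD; apply: eqX => k; rewrite /posp /negp.
case: (leP (q k) 0) => h; first by rewrite max_l ?oppr_ge0 //; ring.
by rewrite max_r ?oppr_le0 ?ltW //; ring.
Qed.

(** Move the negative part of [q] to the side of the apex. If [q] has both a nonpositive and a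
    nonnegative entry, both sides are supported on faces, of which only one contains the apex. *)
Lemma apex_signs s q : (u (inl s) - X q <= Lm)%MS ->
  (forall k, 0 < q k) \/ (forall k, q k < 0).
Proof.
move=> h.
pose t (j : vtx) : R := match j with inl s' => (s' == s)%:R | inr k => negp q k end.
pose t' (j : vtx) : R := match j with inl _ => 0 | inr k => posp q k end.
have t0 j : 0 <= t j by case: j => [s'|k] /=; rewrite ?ler0n // le_max lexx orbT.
have t'0 j : 0 <= t' j by case: j => [s'|k] //=; rewrite le_max lexx orbT.
have [|/existsPn qn] := boolP [exists k, q k <= 0]; last first.
  by left=> k; have := qn k; rewrite -ltNge.
move=> /existsP[k1 qk1].
have [|/existsPn qp] := boolP [exists k, 0 <= q k]; last first.
  by right=> k; have := qp k; rewrite -ltNge.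
move=> /existsP[k2 qk2].
suff : supp t = supp t'.
  by move/setP/(_ (inl s)); rewrite !inE /= eqxx ltr01 ltxx.
apply: bip_supp => //.
- apply/andP; split.
    by rewrite !inE /=; case: (s); rewrite /= ltxx ?andbF.
  apply/existsP; exists k2; rewrite inE /= -leNgt /negp.
  by rewrite max_r // oppr_le0.
- apply/andP; split; first by rewrite !inE /= ltxx.
  by apply/existsP; exists k1; rewrite inE /= -leNgt /posp max_r.
rewrite !sumE /= !scale0r !add0r.
have -> : (true == s)%:R *: u (inl true) + (false == s)%:R *: u (inl false) = u (inl s).
  by case: (s); rewrite scale0r scale1r ?addr0 ?add0r.
by rewrite -addrA -[X _ - _]opprB -posneg.
Qed.

(** The same device; here the two supports are disjoint, so being equal they are empty. *)
Lemma equator_signs q : (X q <= Lm)%MS ->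
  [\/ forall k, q k = 0, forall k, 0 < q k | forall k, q k < 0].
Proof.
move=> h.
pose t (j : vtx) : R := match j with inl _ => 0 | inr k => posp q k end.
pose t' (j : vtx) : R := match j with inl _ => 0 | inr k => negp q k end.
have t0 j : 0 <= t j by case: j => [s'|k] //=; rewrite le_max lexx orbT.
have t'0 j : 0 <= t' j by case: j => [s'|k] //=; rewrite le_max lexx orbT.
have [|/existsPn qn] := boolP [exists k, q k <= 0]; last first.
  by apply: Or32 => k; have := qn k; rewrite -ltNge.
move=> /existsP[k1 qk1].
have [|/existsPn qp] := boolP [exists k, 0 <= q k]; last first.
  by apply: Or33 => k; have := qp k; rewrite -ltNge.
move=> /existsP[k2 qk2].
have e : supp t = supp t'.
  apply: bip_supp => //.
  - apply/andP; split; first by rewrite !inE /= ltxx.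
    by apply/existsP; exists k1; rewrite inE /= -leNgt /posp max_r.
  - apply/andP; split; first by rewrite !inE /= ltxx.
    by apply/existsP; exists k2; rewrite inE /= -leNgt /negp max_r ?oppr_le0.
  by rewrite !sumE /= !scale0r !add0r -posneg.
apply: Or31 => k; have /setP/(_ (inr k)) := e.
by rewrite !inE /= /posp /negp !lt_max ltxx !orbF oppr_gt0; case: ltgtP.
Qed.

Let rowsX (b : pred 'I_3) : 'M[R]_(3, d) :=
  \matrix_(k < 3) (if b k then u (inr k) else 0).

Let sub_rowsX (b : pred 'I_3) k : b k -> (u (inr k) <= Lm + rowsX b)%MS.
Proof.
move=> bk; apply: submx_trans (addsmxSr _ _).
by have := row_sub k (rowsX b); rewrite rowK bk.
Qed.

Let rowsXP (b : pred 'I_3) (z : 'rV[R]_d) : (z <= Lm + rowsX b)%MS ->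
  exists2 q, forall k, ~~ b k -> q k = 0 & (z - X q <= Lm)%MS.
Proof.
case/sub_addsmxP=> -[g1 g2] /= ->.
exists (fun k => if b k then g2 0 k else 0) => [k /negPf->//|].
suff -> : X (fun k => if b k then g2 0 k else 0) = g2 *m rowsX b.
  by rewrite addrK submxMl.
rewrite mulmx_sum_row; apply: eq_bigr => k _; rewrite rowK.
by case: ifP => _; rewrite ?scaler0 ?scale0r.
Qed.

(** Were an apex a combination of the equator modulo L, a multiple of [p] could be subtracted to
    make one coefficient zero, against [apex_signs]. *)
Lemma flat_equator p : (forall k, 0 < p k) -> (X p <= Lm)%MS ->
  exists c : 'rV[R]_d,
    [/\ forall l : 'rV[R]_d, (l <= Lm)%MS -> dot c l = 0,
        forall k, dot c (u (inr k)) = 0,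
        dot c (u (inl true)) < 0 & 0 < dot c (u (inl false))].
Proof.
move=> p0 Lp.
have nq s q : ~~ (u (inl s) - X q <= Lm)%MS.
  apply/negP => h.
  have := @apex_signs s (fun k => q k - q ord0 / p ord0 * p k).
  case=> [|/(_ ord0)|/(_ ord0)]; last 2 first.
  - by rewrite divfK ?gt_eqF // subrr ltxx.
  - by rewrite divfK ?gt_eqF // subrr ltxx.
  have -> : X (fun k => q k - q ord0 / p ord0 * p k) = X q - (q ord0 / p ord0) *: X p.
    by rewrite -scaleN1r scalerA XZ XD; apply: eqX => k; ring.
  by rewrite opprB addrCA addrC addmx_sub // scalemx_sub.
have [|c c0 cF] := @sep_functional R _ _ (Lm + rowsX predT)%MS (u (inl false)).
  by apply/negP => /rowsXP[q _]; apply/negP/nq.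
have cL l : (l <= Lm)%MS -> dot c l = 0.
  by move=> h; apply: c0; apply: submx_trans h (addsmxSl _ _).
have cX k : dot c (u (inr k)) = 0 by apply/c0/sub_rowsX.
exists c; split=> //; rewrite ltNge; apply/negP => cT.
(* Covering the opposite of one apex forces the other apex to the negative side of [c]. *)
have [t [t0 _ /cL]] := bip_cover (- u (inl false)).
rewrite sumE dotBr dotNr !dotDr !dotZr /X dot_sumr big1 => [|k _]; last first.
  by rewrite cX mulr0.
have := mulr_ge0 (t0 (inl true)) cT; have := mulr_ge0 (t0 (inl false)) (ltW cF).
lra.
Qed.

(** The functionals [c k] are dual, up to positive factors, to the equatorial vertices modulo L; on
    the apices they read off coefficients. *)
Lemma pointed_equator : (forall p, (forall k, 0 < p k) -> ~~ (X p <= Lm)%MS) ->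
  exists s (c : 'I_3 -> 'rV[R]_d), forall k,
    [/\ forall l : 'rV[R]_d, (l <= Lm)%MS -> dot (c k) l = 0,
        forall j, j != k -> dot (c k) (u (inr j)) = 0,
        0 < dot (c k) (u (inr k)),
        0 < dot (c k) (u (inl s)) & dot (c k) (u (inl (~~ s))) < 0].
Proof.
move=> nodep.
have indep q : (X q <= Lm)%MS -> forall k, q k = 0.
  move=> h; case: (equator_signs h) => // q0; first by have /negP := nodep q q0.
  have /negP[] : ~~ (X (fun k => -1 * q k)%R <= Lm)%MS.
    by apply: nodep => k; rewrite mulN1r oppr_gt0.
  by rewrite -XZ scalemx_sub.
have split_bip (t : vtx -> R) : (forall j, 0 <= t j) -> bip (supp t) ->
    exists s k, [/\ t (inl s) = 0, t (inr k) = 0 &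
      \sum_j t j *: u j = t (inl (~~ s)) *: u (inl (~~ s)) + X (fun k => t (inr k))].
  move=> t0 /andP[/nandP b /existsP[k]]; rewrite inE -leNgt => tk.
  have [s ts] : exists s, t (inl s) = 0.
    by case: b; rewrite inE -leNgt => h; [exists true|exists false];
      apply/le_anti; rewrite h t0.
  exists s, k; split=> //; first by apply/le_anti; rewrite tk t0.
  by rewrite sumE; case: s ts => /= ->; rewrite scale0r ?add0r ?addr0.
(* Covering minus the sum of the equatorial vertices needs an apex, which is therefore a negative
   combination of them. *)
have [s [p [p0 Lp]]] : exists s p, (forall k, 0 < p k) /\
    ((u (inl s) + X p)%R <= Lm)%MS.
  have [t [t0 tb]] := bip_cover (- X (fun=> 1)).
  have [s [k [_ _ ->]]] := split_bip t t0 tb => h.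
  have [ts|ts] := eqVneq (t (inl (~~ s))) 0.
    have /negP[] := nodep (fun k => 1 + t (inr k)) (fun k => ltr_wpDr (t0 _) ltr01).
    have := scalemx_sub (-1) h.
    by rewrite ts scale0r add0r scaleN1r opprB opprK addrC XD.
  have ts0 : 0 < t (inl (~~ s)) by rewrite lt_def ts t0.
  exists (~~ s), (fun k => (t (inl (~~ s)))^-1 * (1 + t (inr k))); split.
    by move=> j; rewrite mulr_gt0 ?invr_gt0 // ltr_wpDr.
  rewrite -(XZ _ (fun k => 1 + t (inr k))) -(XD (fun=> 1)).
  apply: etrans (scalemx_sub (- (t (inl (~~ s)))^-1) h).
  apply: (congr1 (fun z : 'rV[R]_d => (z <= Lm)%MS)).
  by apply/rowP => i; rewrite !mxE; field.
(* The face covering the sum itself misses some vertex [k0], whose coefficient the negative apex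
   cannot supply. So the other apex occurs, with positive coefficient at [k0], and [apex_signs]
   settles the remaining signs. *)
have [q [q0 Lq]] : exists q, (forall k, 0 < q k) /\ (u (inl (~~ s)) - X q <= Lm)%MS.
  have [t [t0 tb]] := bip_cover (X (fun=> 1)).
  have [s' [k0 [ts' tk0 ->]]] := split_bip t t0 tb => h.
  have [es|es] := eqVneq s' s.
    rewrite es in h ts'.
    have [ts|ts] := eqVneq (t (inl (~~ s))) 0.
      have := indep (fun k => 1 + -1 * t (inr k)); rewrite -XD -XZ scaleN1r.
      rewrite ts scale0r add0r in h => /(_ h k0).
      by rewrite tk0 mulr0 addr0 => /eqP; rewrite oner_eq0.
    have ts0 : 0 < t (inl (~~ s)) by rewrite lt_def ts t0.
    pose q k := (t (inl (~~ s)))^-1 * (1 + -1 * t (inr k)).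
    have Lq : (u (inl (~~ s)) - X q <= Lm)%MS.
      rewrite /q -(XZ _ (fun k => 1 + -1 * t (inr k))) -(XD (fun=> 1)) -XZ.
      apply: etrans (scalemx_sub (- (t (inl (~~ s)))^-1) h).
  apply: (congr1 (fun z : 'rV[R]_d => (z <= Lm)%MS)).
      by apply/rowP => i; rewrite !mxE; field.
    exists q; split=> //; case: (apex_signs Lq) => // /(_ k0).
    by rewrite /q tk0 mulr0 addr0 mulr1 invr_lt0 ltNge ltW.
  have {es} es : ~~ s' = s by move: es; case: (s'); case: (s).
  rewrite es in h.
  have := indep (fun k => 1 + (t (inl s) * p k + -1 * t (inr k))).
  rewrite -(XD (fun=> 1)) -(XD (fun k => t (inl s) * p k)) -!XZ.
  move=> /(_ _ k0) h1.
  have {h1} : 1 + (t (inl s) * p k0 + -1 * t (inr k0)) = 0.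
    apply: h1; apply: etrans (addmx_sub h (scalemx_sub (t (inl s)) Lp)).
    apply: (congr1 (fun z : 'rV[R]_d => (z <= Lm)%MS)).
    by apply/rowP => i; rewrite !mxE; ring.
  rewrite tk0 mulr0 addr0 => /eqP; rewrite gt_eqF // ltr_wpDr //.
  by rewrite mulr_ge0 // ltW.
(* The statement names the positive apex, whereas [s] is the negative one. *)
exists (~~ s); rewrite negbK.
have fk k : exists c : 'rV[R]_d,
    [/\ forall l : 'rV[R]_d, (l <= Lm)%MS -> dot c l = 0,
        forall j, j != k -> dot c (u (inr j)) = 0,
        0 < dot c (u (inr k)),
        0 < dot c (u (inl (~~ s))) & dot c (u (inl s)) < 0].
  have [|c c0 ck] := @sep_functional R _ _ (Lm + rowsX (predC1 k))%MS (u (inr k)).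
    apply/negP => /rowsXP[r rk h].
    have := indep (fun j => (j == k)%:R + -1 * r j); rewrite -XD -XZ scaleN1r.
    have -> : X (fun j => (j == k)%:R) = u (inr k).
      rewrite /X (bigD1 k) //= eqxx scale1r big1 ?addr0 // => j /negPf->.
      exact: scale0r.
    move=> /(_ h k); rewrite eqxx rk ?mulr0 ?addr0 /= ?eqxx //.
    by move/eqP; rewrite oner_eq0.
  have cL l : (l <= Lm)%MS -> dot c l = 0.
    by move=> h; apply: c0; apply: submx_trans h (addsmxSl _ _).
  have cX j : j != k -> dot c (u (inr j)) = 0 by move=> jk; apply/c0/sub_rowsX.
  have cXq r : dot c (X r) = r k * dot c (u (inr k)).
    rewrite /X dot_sumr (bigD1 k) //= big1 ?addr0 // => j jk.
    by rewrite cX ?mulr0.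
  exists c; split=> //.
    have /eqP := cL _ Lq; rewrite dotBr cXq subr_eq0 => /eqP ->.
    exact: mulr_gt0.
  have /eqP := cL _ Lp; rewrite dotDr cXq addr_eq0 => /eqP ->.
  by rewrite oppr_lt0 mulr_gt0.
by have [c cP] := choice fk; exists c.
Qed.

End BipyramidFan.

(** * The face lattice of the prism *)

Section Prism.
Context {R : realType}.
Implicit Types (z : 'rV[R]_(2 + 1)) (j : vtx) (J : {set vtx}).

Let X0 : 'I_(2 + 1) := lshift 1 ord0.
Let X1 : 'I_(2 + 1) := lshift 1 (lift ord0 ord0).
Let X2 : 'I_(2 + 1) := rshift 2 ord0.

Let rowP3 (x y : 'rV[R]_(2 + 1)) :
  x 0 X0 = y 0 X0 -> x 0 X1 = y 0 X1 -> x 0 X2 = y 0 X2 -> x = y.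
Proof.
move=> h0 h1 h2; apply/rowP => i; case: (split_ordP i) => k ->.
  have [->|->//] : k = ord0 \/ k = lift ord0 ord0.
    by case: k => -[|[|//]] ?; [left|right]; apply/val_inj.
  exact: h0.
by rewrite (ord1 k).
Qed.

Definition slack j z : R := match j with
  | inl true => z 0 X2
  | inl false => 1 - z 0 X2
  | inr k => match val k with
    | 0%N => z 0 X0
    | 1%N => z 0 X1
    | _ => 1 - z 0 X0 - z 0 X1
    end
  end.

Let dlt (i : 'I_(2 + 1)) : 'rV[R]_(2 + 1) := delta_mx 0 i.

Let dot_dlt i z : dot (dlt i) z = z 0 i.
Proof.
rewrite /dot (bigD1 i) //= mxE !eqxx mul1r big1 ?addr0 // => k ki.
by rewrite mxE (negPf ki) mul0r.
Qed.

Lemma slack_affine j : exists (c : 'rV[R]_(2 + 1)) (b : R),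
  forall z, slack j z = dot c z + b.
Proof.
case: j => [[]|[[|[|k]] hk]] /=.
- by exists (dlt X2), 0 => z; rewrite dot_dlt addr0.
- by exists (- dlt X2), 1 => z; rewrite dotNl dot_dlt addrC.
- by exists (dlt X0), 0 => z; rewrite dot_dlt addr0.
- by exists (dlt X1), 0 => z; rewrite dot_dlt addr0.
- exists (- dlt X0 - dlt X1), 1 => z.
  by rewrite dotDl !dotNl !dot_dlt; ring.
Qed.

Lemma slack_sum j (I : finType) (w : I -> R) (x : I -> 'rV[R]_(2 + 1)) :
  \sum_i w i = 1 -> slack j (\sum_i w i *: x i) = \sum_i w i * slack j (x i).
Proof.
move=> w1; have [c [b cb]] := slack_affine j.
rewrite cb dot_sumr -[b]mul1r -w1 mulr_suml -big_split.
by apply: eq_bigr => i _ /=; rewrite cb mulrDr.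
Qed.

(** Bottom and top never meet; with [slack_equator], which keeps the three sides from meeting, this
    is the origin of [bip]. *)
Lemma slack_apex z : slack (inl true) z + slack (inl false) z = 1.
Proof. by rewrite /= addrC subrK. Qed.

Lemma slack_equator z : \sum_k slack (inr k) z = 1.
Proof. by rewrite !big_ord_recl big_ord0 /=; ring. Qed.

Let tri_vtx (k : 'I_3) : 'rV[R]_2 := match val k with
  | 0%N => delta_mx 0 0 | 1%N => delta_mx 0 1 | _ => 0 end.

Lemma triangleP (y : 'rV[R]_2) : triangle y <->
  [/\ 0 <= y 0 0, 0 <= y 0 1 & 0 <= 1 - y 0 0 - y 0 1].
Proof.
split=> [[k [v [w [vT w0 w1 ->]]]]|[y0 y1 y2]].
  have vP i : [/\ 0 <= v i 0 0, 0 <= v i 0 1 & 0 <= 1 - v i 0 0 - v i 0 1].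
    by case: (vT i) => ->; rewrite !mxE /= ?eqxx /= ?mulr0n ?mulr1n; split; lra.
  rewrite !summxE; split.
  - by apply: sumr_ge0 => i _; rewrite mxE mulr_ge0 //; case: (vP i).
  - by apply: sumr_ge0 => i _; rewrite mxE mulr_ge0 //; case: (vP i).
  rewrite -w1 -!sumrB; apply: sumr_ge0 => i _; rewrite !mxE.
  have [_ _ h] := vP i; have := mulr_ge0 (w0 i) h; lra.
pose w (k : 'I_3) := match val k with
  | 0%N => y 0 0 | 1%N => y 0 1 | _ => 1 - y 0 0 - y 0 1 end.
exists 3%N, tri_vtx, w; split.
- by case=> -[|[|k]] hk /=; [apply: Or32|apply: Or33|apply: Or31].
- by case=> -[|[|k]] hk.
- by rewrite !big_ord_recl big_ord0 /w /=; ring.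
rewrite !big_ord_recl big_ord0 /w /tri_vtx /=.
apply/rowP => i; rewrite !mxE.
have [->|->] : i = 0 \/ i = 1.
  by case: i => -[|[|//]] ?; [left|right]; apply/val_inj.
all: by rewrite /= ?eqxx /= ?mulr0n ?mulr1n; ring.
Qed.

Lemma prismP z : prism (@triangle R) z <-> forall j, 0 <= slack j z.
Proof.
have e0 : lshift 1 (0 : 'I_2) = X0 by apply/val_inj.
have e1 : lshift 1 (1 : 'I_2) = X1 by apply/val_inj.
split=> [[y [t [/triangleP[y0 y1 y2] /andP[t0 t1] ->]]] j|h].
  case: j => [[]|[[|[|k]] hk]] /=;
  rewrite -?e0 -?e1 ?(row_mxEl y (const_mx t)) ?(row_mxEr y (const_mx t)) ?mxE //.
  by rewrite subr_ge0.
exists (lsubmx z), (z 0 X2); split.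
- apply/triangleP; rewrite !mxE e0 e1; split.
  + exact: (h (inr ord0)).
  + exact: (h (inr (lift ord0 ord0))).
  + exact: (h (inr ord_max)).
- by apply/andP; split; [exact: (h (inl true))|rewrite -subr_ge0; exact: (h (inl false))].
apply: rowP3.
- by rewrite (row_mxEl (lsubmx z)) mxE.
- by rewrite (row_mxEl (lsubmx z)) mxE.
- by rewrite (row_mxEr (lsubmx z)) mxE.
Qed.

Definition slack_face J : set 'rV[R]_(2 + 1) :=
  [set z | prism (@triangle R) z /\ forall j, j \in J -> slack j z = 0].

Lemma slack_witness J : bip J -> exists2 z, prism (@triangle R) z &
  forall j, (j \in J <-> slack j z = 0).
Proof.
case/andP=> Jb /existsP[k0 Jk0].
(* Height 1/2 leaves both apex slacks positive; the side slacks are made equal outside [J]. *)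
pose t : R := if inl true \in J then 0 else if inl false \in J then 1 else 1 / 2.
pose e (k : 'I_3) : R := (inr k \notin J)%:R; pose s := \sum_k e k.
have e0 k : 0 <= e k by rewrite ler0n.
have s0 : 0 < s.
  by rewrite /s (bigD1 k0) //= ltr_pwDl ?sumr_ge0 // /e Jk0 ltr01.
have sE : s = e ord0 + e (lift ord0 ord0) + e ord_max.
  rewrite /s !big_ord_recl big_ord0 addr0 addrA; congr (_ + _ + e _).
  exact/val_inj.
pose z : 'rV[R]_(2 + 1) := \row_i (if i == X2 then t else
  if i == X0 then e ord0 / s else e (lift ord0 ord0) / s).
have zk k : slack (inr k) z = e k / s.
  have [->|[->|->]] : k = ord0 \/ k = lift ord0 ord0 \/ k = ord_max.
    by case: k => -[|[|[|//]]] ?; [left|right; left|right; right]; apply/val_inj.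
  - by rewrite /= mxE.
  - by rewrite /= mxE.
  - by rewrite /= !mxE /= sE; field; rewrite -sE gt_eqF.
have zT : slack (inl true) z = t by rewrite /= mxE eqxx.
have zF : slack (inl false) z = 1 - t by rewrite /= mxE eqxx.
have zP j : 0 <= slack j z /\ (j \in J <-> slack j z = 0).
  case: j => [b|k]; last first.
    rewrite zk; split; first by rewrite divr_ge0 // ltW.
    rewrite /e; case: (inr k \in J); split=> //; first by rewrite mul0r.
    by move/eqP; rewrite mul1r invr_eq0 gt_eqF.
  case: b; rewrite ?zT ?zF /t; move: Jb;
  case: (inl true \in J); case: (inl false \in J) => //= _; split; try lra;
  by split=> // h; exfalso; lra.
exists z; first by apply/prismP => j; case: (zP j).
by move=> j; case: (zP j).
Qed.

(** Exposed by the sum of the slacks in [J], which vanishes on the prism only where each term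
    does. *)
Lemma slack_face_complex J : bip J ->
  face_complex (prism (@triangle R)) (slack_face J).
Proof.
move=> Jb; split; last first.
  by have [z zP zJ] := slack_witness Jb; exists z; split=> // j /zJ.
have /choice[c cP] : forall j, exists cb : 'rV[R]_(2 + 1) * R,
    forall z, slack j z = dot cb.1 z + cb.2.
  by move=> j; have [c [b h]] := slack_affine j; exists (c, b).
pose C := \sum_(j in J) (-1) *: (c j).1; pose b := \sum_(j in J) (c j).2.
have dotC z : b - dot C z = \sum_(j in J) slack j z.
  have -> : dot C z = \sum_(j in J) - dot (c j).1 z.
    rewrite /C; elim/big_rec2: _ => [|j a y _ <-]; first exact: dot0l.
    by rewrite dotDl dotZl mulN1r.
  by rewrite /b -sumrB; apply: eq_bigr => j _; rewrite cP opprK addrC.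
exists C, b; split=> [z /prismP h|].
  by rewrite -subr_ge0 dotC; apply: sumr_ge0.
apply/seteqP; split=> z [zP h]; split=> //.
  by apply/esym/subr0_eq; rewrite dotC big1.
have /eqP := h; rewrite eq_sym -subr_eq0 dotC => /eqP/psumr_eq0P; apply.
by move=> j _; move/prismP: zP; apply.
Qed.

(** [J] collects the facets containing [G], and an average [r] of points of [G] lies on no other
    facet. For [z] in [slack_face J], the segment from [z] to [r] can be prolonged inside the prism,
    so the functional exposing [G] is maximal at [z] too. *)
Lemma slack_face_surj (G : set 'rV[R]_(2 + 1)) :
  face_complex (prism (@triangle R)) G -> exists2 J, bip J & G = slack_face J.
Proof.
move=> [[c [b [cb GE]]] [z0 Gz0]].
pose J := [set j | `[< forall z, G z -> slack j z = 0 >]]%SET.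
have GP z : G z -> prism (@triangle R) z by rewrite GE => -[].
have /choice[w wP] : forall j, exists z, G z /\ (j \notin J -> 0 < slack j z).
  move=> j; have [jJ|jJ] := boolP (j \in J); first by exists z0.
  move: jJ; rewrite inE => /asboolP/existsNP[z /not_implyP[Gz nz]].
  exists z; split=> // _; rewrite lt_def; apply/andP; split; first exact/eqP.
  by move/GP/prismP: Gz.
pose n : R := #|vtx|%:R.
have n0 : 0 < n by rewrite ltr0n; apply/card_gt0P; exists (inl true).
have n1 : \sum_(j : vtx) n^-1 = 1.
  by rewrite sumr_const -(mulr_natr n^-1) mulVf ?gt_eqF.
pose r := \sum_(j : vtx) n^-1 *: w j.
have rS j : slack j r = \sum_(i : vtx) n^-1 * slack j (w i) by apply: slack_sum.
have wS j i : 0 <= n^-1 * slack j (w i).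
  rewrite mulr_ge0 ?invr_ge0 ?(ltW n0) //.
  by have [/GP/prismP h _] := wP i.
have Pr : prism (@triangle R) r by apply/prismP => j; rewrite rS sumr_ge0.
have Gr : G r.
  rewrite GE; split=> //; rewrite /r dot_sumr -[b]mul1r -n1 mulr_suml.
  by apply: eq_bigr => j _; have [+ _] := wP j; rewrite GE => -[_ ->].
have rpos j : j \notin J -> 0 < slack j r.
  move=> jJ; rewrite rS (bigD1 j) //= ltr_pwDl ?sumr_ge0 //.
  by rewrite mulr_gt0 ?invr_gt0 //; have [_] := wP j; apply.
have rJ j : j \in J -> slack j r = 0 by rewrite inE => /asboolP; apply.
exists J.
  apply/andP; split.
    apply/negP => /andP[/rJ hT /rJ hF].
    by have := slack_apex r; rewrite hT hF addr0 => /eqP; rewrite eq_sym oner_eq0.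
  apply/existsP; apply: contrapT => nk.
  have := slack_equator r; rewrite big1 => [/eqP|k _].
    by rewrite eq_sym oner_eq0.
  by apply/rJ/negPn/negP => h; apply: nk; exists k.
apply/seteqP; split=> z.
  by move=> Gz; split; [exact: GP|move=> j; rewrite inE => /asboolP; apply].
move=> [Pz zJ]; rewrite GE; split=> //; apply/le_anti; rewrite cb //=.
have [e e0 He] := @small_step R vtx (fun j => j \notin J) (fun j => slack j r)
  (fun j => slack j r - slack j z) rpos.
(* The point slightly beyond [r] as seen from [z], put as an indexed sum so that [slack_sum]
   applies. *)
pose y := \sum_(i : bool) (if i then 1 + e else - e) *: (if i then r else z).
have y1 : \sum_(i : bool) (if i then 1 + e else - e) = 1 by rewrite big_bool /= addrK.
have Py : prism (@triangle R) y.
  apply/prismP => j; rewrite slack_sum // big_bool /=.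
  have [jJ|jJ] := boolP (j \in J); first by rewrite rJ // zJ // !mulr0 addr0.
  have := He e; rewrite lexx ltW // => /(_ isT j jJ); lra.
have := cb y Py; rewrite /y dot_sumr big_bool /=.
have -> : dot c r = b by move: Gr; rewrite GE => -[].
move=> h; have : e * b <= e * dot c z by lra.
by rewrite ler_pM2l.
Qed.

Lemma slack_face_le J J' : bip J -> bip J' ->
  (J \subset J' <-> slack_face J' `<=` slack_face J).
Proof.
move=> Jb J'b; split=> [/fintype.subsetP JJ' z [zP h]|h].
  by split=> // j /JJ'; apply: h.
have [z zP zJ] := slack_witness J'b.
have [_ hz] : slack_face J z by apply: h; split=> // j /zJ.
by apply/fintype.subsetP => j /hz /zJ.
Qed.

Let pvtx (a : bool * 'I_3) : 'rV[R]_(2 + 1) :=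
  row_mx (tri_vtx a.2) (const_mx a.1%:R).

Let pweight z (a : bool * 'I_3) : R := slack (inl a.1) z * slack (inr a.2) z.

Let pweight_sum z : \sum_a pweight z a = 1.
Proof.
rewrite -(pair_bigA _ (fun s k => slack (inl s) z * slack (inr k) z)) /=.
under eq_bigr => s _ do rewrite -mulr_sumr slack_equator mulr1.
by rewrite big_bool; exact: slack_apex.
Qed.

(** Valid for [z] outside the prism as well, so the same weights give the convex hull in
    [prism_polytope] and the affine hull in [prism_dim]. *)
Let prism_decomp z : z = \sum_a pweight z a *: pvtx a.
Proof.
rewrite -(pair_bigA _ (fun s k => pweight z (s, k) *: pvtx (s, k))) /=.
rewrite big_bool !big_ord_recl !big_ord0 /pweight /pvtx /tri_vtx /=.
have r0 (y : 'rV[R]_2) (t : 'rV[R]_1) : row_mx y t 0 X0 = y 0 ord0.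
  exact: row_mxEl.
have r1 (y : 'rV[R]_2) (t : 'rV[R]_1) : row_mx y t 0 X1 = y 0 (lift ord0 ord0).
  exact: row_mxEl.
have r2 (y : 'rV[R]_2) (t : 'rV[R]_1) : row_mx y t 0 X2 = t 0 ord0.
  exact: row_mxEr.
have sc (a : R) (y : 'rV[R]_(2 + 1)) i : (a *: y) 0 i = a * y 0 i by rewrite mxE.
have ad (x y : 'rV[R]_(2 + 1)) i : (x + y) 0 i = x 0 i + y 0 i by rewrite mxE.
have ze i : (0 : 'rV[R]_(2 + 1)) 0 i = 0 by rewrite mxE.
by apply: rowP3; rewrite !(ad, sc, ze, r0, r1, r2) !mxE /= ?mulr0n ?mulr1n; ring.
Qed.

Let pvtx_prism a : prism (@triangle R) (pvtx a).
Proof.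
exists (tri_vtx a.2), a.1%:R; split=> //; last first.
  by case: (a.1); rewrite /= ?lexx ler01.
apply/triangleP; rewrite /tri_vtx.
by case: (val a.2) => [|[|k]]; rewrite !mxE /= ?mulr0n ?mulr1n; split; lra.
Qed.

Lemma prism_polytope : polytope (prism (@triangle R)).
Proof.
exists (range pvtx); first exact/finite_image/finite_finset.
apply/seteqP; split=> z.
  move/prismP=> h; exists #|{: bool * 'I_3}|, (fun i => pvtx (enum_val i)),
    (fun i => pweight z (enum_val i)); split.
  - by move=> i; exists (enum_val i).
  - by move=> i; rewrite mulr_ge0.
  - by rewrite -[RHS](pweight_sum z) [RHS](reindex _ (onW_bij _ (@enum_val_bij _))).
  - rewrite [LHS]prism_decomp.
    by rewrite [LHS](reindex _ (onW_bij _ (@enum_val_bij _))).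
move=> [k [v [w [vP w0 w1 ->]]]]; apply/prismP => j; rewrite slack_sum //.
apply: sumr_ge0 => i _; rewrite mulr_ge0 //; have [a _ <-] := vP i.
by have /prismP := pvtx_prism a; apply.
Qed.

Lemma prism_dim : has_dim (prism (@triangle R)) 3.
Proof.
exists 0, fullv; split; last by rewrite dimvf /dim /= mul1n.
apply/seteqP; split=> z _ /=; first exact: memvf.
exists #|{: bool * 'I_3}|, (fun i => pvtx (enum_val i)),
    (fun i => pweight z (enum_val i)); split.
- by move=> i; apply: pvtx_prism.
- by rewrite -[RHS](pweight_sum z) [RHS](reindex _ (onW_bij _ (@enum_val_bij _))).
- rewrite [LHS]prism_decomp.
  by rewrite [LHS](reindex _ (onW_bij _ (@enum_val_bij _))).
Qed.

End Prism.

(** * Merging cells of a subdivision *)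

Section Merge.
Context {R : realType} {d : nat} {A : pointConfig R d}.
Context (S : {set {set label A}}) (subS : subdivision S).
Implicit Types (F G M N W : {set label A}) (r c : 'rV[R]_d).

(** The last clause is about labels: [M] and [N] select the same ones on the hyperplane, so they
    share a face as subconfigurations. *)
Definition separated M N : Prop := exists c (b : R),
  [/\ forall i, i \in M -> dot c (pt i) <= b,
      forall i, i \in N -> b <= dot c (pt i) &
      forall i, dot c (pt i) = b -> (i \in M) = (i \in N)].

Lemma face_restrict M F W : face M F -> F \subset W -> W \subset M -> face W F.
Proof.
move=> /faceP[c [b [cb FP]]] /fintype.subsetP FW /fintype.subsetP WM.
apply/faceP; exists c, b; split=> [i /WM|i]; first exact: cb.
by rewrite FP; split=> [[iM e]|[/WM]//]; split=> //; apply/FW/FP.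
Qed.

(* Both carriers lie in the common face of M and N on the separating hyperplane. *)
Lemma separated_faces M N F G r : separated M N -> face M F -> face N G ->
  strict_hull F r -> strict_hull G r -> F = G.
Proof.
move=> [c [b [cM cN MN]]] MF NG Fr Gr.
have FM := fintype.subsetP (face_sub MF); have GN := fintype.subsetP (face_sub NG).
have cN' i : i \in N -> dot (- c) (pt i) <= - b by move/cN; rewrite dotNl lerN2.
have rb : dot c r = b.
  apply/le_anti/andP; split.
    by apply: (dot_hull_le _ (strict_hullW Fr)) => i /FM; apply: cM.
  rewrite -lerN2 -dotNl; apply: (dot_hull_le _ (strict_hullW Gr)) => i /GN.
  exact: cN'.
have Fb := dot_strict_hull_eq (fun i h => cM i (FM i h)) Fr rb.
have Gb i : i \in G -> dot c (pt i) = b.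
  move=> iG; apply: oppr_inj; rewrite -dotNl.
  apply: (dot_strict_hull_eq (fun i h => cN' i (GN i h)) Gr) => //.
  by rewrite dotNl rb.
pose W := [set i in M | dot c (pt i) == b]%SET.
have WM : W \subset M by apply/fintype.subsetP => i; rewrite inE => /andP[].
have WN : W \subset N.
  by apply/fintype.subsetP => i; rewrite inE => /andP[iM /eqP/MN <-].
have FW : F \subset W.
  by apply/fintype.subsetP => i iF; rewrite inE FM //= Fb.
have GW : G \subset W.
  by apply/fintype.subsetP => i iG; rewrite inE MN ?Gb // eqxx andbT GN.
exact: face_uniq (face_restrict MF FW WM) (face_restrict NG GW WN) Fr Gr.
Qed.

(** The faces of the cells in [MM] form a coarser subdivision [T]. The cell [M0] distinguishes it
    from [S], and the absence of the full label set makes it non-trivial. *)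
Lemma merge_not_coarsest (MM : {set {set label A}}) (M0 : {set label A}) :
  (forall F, F \in S -> exists2 M, M \in MM & F \subset M) ->
  (forall M N, M \in MM -> N \in MM -> M <> N ->
     [\/ M \in S /\ N \in S, separated M N | separated N M]) ->
  (forall M, M \in MM -> M != [set: label A]%SET) ->
  M0 \in MM -> M0 \notin S -> ~ coarsest S.
Proof.
move=> cover pairs proper M0MM M0S [_ _].
pose T := [set G | `[< exists2 M, M \in MM & face M G >]]%SET; move/(_ T).
have TP G : G \in T <-> exists2 M, M \in MM & face M G.
  by rewrite inE; split=> [/asboolP|h]; last exact/asboolP.
have coarsT : coarsens T S.
  move=> F /cover[M MMM FM]; exists M => //; apply/TP; exists M => //.
  exact: face_refl.
case=> //.
- split.
  + move=> F G /TP[M MMM MF] FG; apply/TP; exists M => //; exact: face_trans FG.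
  + apply/seteqP; split=> x.
      by move=> [F _ Fx]; apply: hullS Fx; apply: finset.subsetT.
    case: (subS) => _ <- _ [F /= /coarsT[G GT FG] Fx].
    by exists G => //; apply: hullS Fx.
  move=> F G /TP[M MMM MF] /TP[N NMM NG] FG; apply/seteqP; split=> // r.
  move=> [/relintP Fr /relintP Gr]; apply: FG.
  have [MN|MN] := pselect (M = N).
    by rewrite -MN in NG; apply: face_uniq NG Fr Gr.
  case: (pairs M N MMM NMM MN) => [[MS NS]|s|s].
  + apply: (subdivision_uniq subS _ _ Fr Gr).
      exact: subdivision_face MF.
    exact: subdivision_face NG.
  + exact: separated_faces s MF NG Fr Gr.
  + by apply/esym; apply: separated_faces s NG MF Gr Fr.
- move=> TS; move/negP: M0S; apply; rewrite -TS; apply/TP; exists M0 => //.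
  exact: face_refl.
move=> /(_ [set: label A]%SET)[_ /(_ (face_refl _))]/TP[M MMM /face_sub sM].
have /negP := proper M MMM; apply; rewrite finset.eqEsubset sM andbT.
exact: finset.subsetT.
Qed.

End Merge.

(** * Subdivisions whose interior faces form a triangular bipyramid *)

Lemma bipS (J J' : {set vtx}) : J \subset J' -> bip J' -> bip J.
Proof.
move=> /fintype.subsetP JJ' /andP[J'b /existsP[k J'k]]; apply/andP; split.
  by apply: contra J'b => /andP[/JJ' -> /JJ' ->].
by apply/existsP; exists k; apply: contra J'k => /JJ'.
Qed.

Lemma bip0 : bip finset.set0.
Proof. by apply/andP; split; [rewrite !inE|apply/existsP; exists ord0; rewrite inE]. Qed.

Lemma bip1 (j : vtx) : bip [set j]%SET.
Proof.
apply/andP; split; first by rewrite !inE; case: j => [[]|].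
apply/existsP; case: j => [s|k]; first by exists ord0; rewrite inE.
(* Addition in ['I_3] is modulo 3, so [k + 1] differs from [k]. *)
by exists (k + 1); rewrite inE (inj_eq inr_inj) -subr_eq0 addrC addKr oner_eq0.
Qed.

(** The six triangles of the bipyramid: an apex and the equatorial edge opposite to [k]. *)
Definition bip_cell (s : bool) (k : 'I_3) : {set vtx} :=
  [set j : vtx | match j with inl s' => s' == s | inr k' => k' != k end]%SET.

Lemma bip_cellP s k : bip (bip_cell s k).
Proof.
apply/andP; split; first by rewrite !inE; case: s.
by apply/existsP; exists k; rewrite inE eqxx.
Qed.

Lemma bip_cell_cover J : bip J -> exists s k, J \subset bip_cell s k.
Proof.
case/andP=> Jb /existsP[k Jk].
exists (inl false \notin J), k; apply/fintype.subsetP => -[s|k'] jJ; rewrite inE.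
  by case: s jJ => jJ; [move: Jb; rewrite jJ /= => ->|rewrite jJ].
by apply: contraNneq Jk => <-.
Qed.

Section BipyramidSubdivision.
Context {R : realType} {d : nat} {A : pointConfig R d}.
Context (S : {set {set label A}}) (subS : subdivision S).
Context (Fc : {set vtx} -> {set label A}).
Context (Fc_int : forall J, bip J -> interior_face S (Fc J)).
Context (Fc_surj : forall K, interior_face S K -> exists2 J, bip J & K = Fc J).
Context (Fc_le : forall J J', bip J -> bip J' -> (Fc J \subset Fc J' <-> J \subset J')).
Implicit Types (J : {set vtx}) (v c l : 'rV[R]_d) (s : bool) (k : 'I_3).

Let F0 := Fc finset.set0.

Let intF0 : interior_face S F0. Proof. exact/Fc_int/bip0. Qed.

Let minF0 K : interior_face S K -> F0 \subset K.
Proof.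
by case/Fc_surj=> J Jb ->; apply/Fc_le; rewrite ?bip0 ?finset.sub0set.
Qed.

Let Fc_inj J J' : bip J -> bip J' -> Fc J = Fc J' -> J = J'.
Proof.
move=> Jb J'b e; apply/eqP; rewrite finset.eqEsubset.
by apply/andP; split; apply/Fc_le => //; rewrite e.
Qed.

Context (p0 : 'rV[R]_d) (F0p0 : strict_hull F0 p0).
Context (u : vtx -> 'rV[R]_d) (Fu : forall j, open_cone p0 (Fc [set j]%SET) (u j)).

Local Notation vec := (vec p0).
Local Notation cone := (cone p0).
Local Notation open_cone := (open_cone p0).

Let vec_gen J i : bip J -> i \in Fc J -> exists (t : vtx -> R) l,
  [/\ forall j, 0 <= t j, forall j, j \notin J -> t j = 0, cone F0 l &
    vec i = l + \sum_j t j *: u j].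
Proof.
move=> Jb iJ.
have [||t [l [t0 Ll e]]] := @cone_generated _ _ _ S subS F0 intF0 minF0 p0 F0p0
    vtx (mem J) (fun j => Fc [set j]%SET) u (Fc J) (Fc_int Jb) _ _ i iJ.
- move=> j jJ; split; [exact/Fc_int/bip1| | |exact: Fu]; last first.
    by apply/Fc_le; rewrite ?bip1 ?finset.sub1set.
  apply/eqP => /Fc_inj e; have /setP/(_ j) := e (bip1 j) bip0.
  by rewrite !inE eqxx.
- move=> K /Fc_surj[J' J'b ->] /Fc_le J'J; rewrite /F0.
  have [->|] := eqVneq J' finset.set0; first by rewrite eqxx.
  case/set0Pn=> j jJ' _; exists j; first by apply: (fintype.subsetP (J'J _ _)).
  by apply/Fc_le => //; rewrite ?bip1 ?finset.sub1set.
exists (fun j => if j \in J then t j else 0), l; split=> //.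
- by move=> j; case: ifP.
- by move=> j /negPf->.
rewrite e; congr (_ + _); rewrite big_mkcond; apply: eq_bigr => j _ /=.
by case: ifP; rewrite // scale0r.
Qed.

Let cone_gen J v : bip J -> cone (Fc J) v -> exists (t : vtx -> R) l,
  [/\ forall j, 0 <= t j, forall j, j \notin J -> t j = 0, cone F0 l &
    v = l + \sum_j t j *: u j].
Proof.
move=> Jb [w [w0 ->]].
have /choice[T TP] : forall i, exists tl : (vtx -> R) * 'rV[R]_d, i \in Fc J ->
    [/\ forall j, 0 <= tl.1 j, forall j, j \notin J -> tl.1 j = 0, cone F0 tl.2 &
      vec i = tl.2 + \sum_j tl.1 j *: u j].
  move=> i; have [iJ|iJ] := boolP (i \in Fc J); last by exists (fun=> 0, 0).
  by have [t [l h]] := vec_gen Jb iJ; exists (t, l).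
exists (fun j => \sum_(i in Fc J) w i * (T i).1 j), (\sum_(i in Fc J) w i *: (T i).2).
split.
- by move=> j; apply: sumr_ge0 => i iJ; rewrite mulr_ge0 ?w0 //; case: (TP i iJ).
- by move=> j jJ; apply: big1 => i iJ; case: (TP i iJ) => _ -> //; rewrite mulr0.
- by apply: cone_sum => // i iJ; case: (TP i iJ).
have -> : \sum_j (\sum_(i in Fc J) w i * (T i).1 j) *: u j =
    \sum_(i in Fc J) w i *: \sum_j (T i).1 j *: u j.
  under eq_bigr => j _ do rewrite scaler_suml.
  rewrite exchange_big; apply: eq_bigr => i _ /=; rewrite scaler_sumr.
  by apply: eq_bigr => j _; rewrite scalerA.
rewrite -big_split; apply: eq_bigr => i iJ /=; rewrite -scalerDr.
by case: (TP i iJ) => _ _ _ <-.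
Qed.

(** The functional exposing the carrier [K] is nonpositive on the rays and zero on their positive
    combination, hence zero on each ray of the support; so [K] contains all their cells. *)
Let open_supp (t : vtx -> R) l : (forall j, 0 <= t j) -> bip (supp t) ->
  cone F0 l -> open_cone (Fc (supp t)) (l + \sum_j t j *: u j).
Proof.
move=> t0 tb Ll; set v := _ + _; pose J := supp t.
have uJ j : j \in J -> cone (Fc J) (u j).
  move=> jJ; apply: coneS (open_coneW (Fu j)).
  by apply/Fc_le; rewrite ?bip1 ?finset.sub1set.
have vE : v = l + \sum_(j in J) t j *: u j.
  rewrite /v; congr (_ + _); rewrite [RHS]big_mkcond; apply: eq_bigr => j _ /=.
  rewrite inE; case: ltP => // tj.
  by have -> : t j = 0 by [apply/le_anti; rewrite tj t0]; rewrite scale0r.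
have Jv : cone (Fc J) v.
  rewrite vE; apply: coneD; first by apply: coneS Ll; apply/minF0/Fc_int.
  by apply: cone_sum => // j _.
have [K [c [iK KJ Kv c0 cK]]] := fan_carrier subS intF0 minF0 F0p0 (Fc_int tb) Jv.
suff -> : Fc J = K by [].
have [J' J'b KE] := Fc_surj iK; rewrite KE.
apply/eqP; rewrite finset.eqEsubset -{2}KE KJ andbT; apply/Fc_le => //.
have F0J := fintype.subsetP (minF0 (Fc_int tb)).
have cl : dot c l = 0.
  by apply: (dot_cone_F0 F0p0 _ Ll) => i /F0J; apply: c0.
have cv : dot c v = 0.
  have [w [_ ->]] := Kv; rewrite dot_sumr big1 // => i iiK.
  by rewrite (cK i (fintype.subsetP KJ i iiK)).1 ?mulr0.
have cu j : j \in J -> dot c (u j) <= 0.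
  by move=> /uJ; apply: dot_cone_le0.
apply/fintype.subsetP => j jJ.
have cuj : dot c (u j) = 0.
  move: cv; rewrite vE dotDr cl add0r dot_sumr => /eqP.
  rewrite -oppr_eq0 -sumrN => /eqP/psumr_eq0P h.
  have /eqP : - (t j * dot c (u j)) = 0.
    by apply: h jJ => j' j'J; rewrite oppr_ge0 mulr_ge0_le0 ?cu.
  rewrite oppr_eq0 mulf_eq0 gt_eqF ?orFb => [/eqP//|].
  by move: jJ; rewrite inE.
rewrite -finset.sub1set; apply/Fc_le => //; rewrite -?KE ?bip1 //.
have jF : Fc [set j]%SET \subset Fc J by apply/Fc_le; rewrite ?bip1 ?finset.sub1set.
have jF' := fintype.subsetP jF.
apply/fintype.subsetP => i iij; apply/cK; first exact: jF'.
exact: (dot_open_cone_eq0 (fun i h => c0 i (jF' i h)) (Fu j) cuj).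
Qed.

Let mem_supp J i : bip J -> i \in Fc J -> exists (t : vtx -> R) l,
  [/\ forall j, 0 <= t j, supp t \subset J, cone F0 l,
    vec i = l + \sum_j t j *: u j & i \in Fc (supp t)].
Proof.
move=> Jb iJ; have [t [l [t0 tJ Ll e]]] := vec_gen Jb iJ.
have sJ : supp t \subset J.
  apply/fintype.subsetP => j; rewrite inE; apply: contraLR => /tJ ->.
  by rewrite ltxx.
exists t, l; split=> //.
apply: (fan_mem subS intF0 minF0 F0p0 (Fc_int Jb) iJ (Fc_int (bipS sJ Jb))).
by rewrite e; apply: open_supp (bipS sJ Jb) Ll.
Qed.

(** Presents the linear space [cone F0] as a row space, with zero rows for the labels outside
    [F0]. *)
Let Lm : 'M[R]_(#|label A|, d) :=
  \matrix_k (if enum_val k \in F0 then vec (enum_val k) else 0).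

Let LmP l : (l <= Lm)%MS <-> cone F0 l.
Proof.
split=> [/submxP[g ->]|[w [_ ->]]].
  have -> : g *m Lm = \sum_(i in F0) g 0 (enum_rank i) *: vec i.
    rewrite mulmx_sum_row [RHS](reindex _ (onW_bij _ (@enum_val_bij (label A)))).
    rewrite [RHS]big_mkcond /=; apply: eq_bigr => k _; rewrite rowK enum_valK.
    by case: ifP => // _; rewrite scaler0.
  apply: (big_ind (cone F0)); [exact: cone0|exact: coneD|] => i iF.
  have [g0|g0] := leP 0 (g 0 (enum_rank i)).
    exact/coneZ/cone_vec.
  rewrite -[_ *: _]opprK; apply: cone_F0N => //; rewrite -scaleNr.
  by apply: coneZ (cone_vec _ iF); rewrite oppr_ge0 ltW.
apply: summx_sub => i iF; apply: scalemx_sub.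
by have := row_sub (enum_rank i) Lm; rewrite rowK enum_rankK iF.
Qed.

Let cover v : exists t : vtx -> R,
  [/\ forall j, 0 <= t j, bip (supp t) & ((v - \sum_j t j *: u j)%R <= Lm)%MS].
Proof.
have [K /Fc_surj[J Jb ->] Jv] := fan_complete subS intF0 F0p0 v.
have [t [l [t0 tJ Ll e]]] := cone_gen Jb (open_coneW Jv).
exists t; split=> //; last by apply/LmP; rewrite e addrK.
apply: bipS Jb; apply/fintype.subsetP => j; rewrite inE.
by apply: contraLR => /tJ ->; rewrite ltxx.
Qed.

Let uniq_supp (t t' : vtx -> R) :
  (forall j, 0 <= t j) -> (forall j, 0 <= t' j) -> bip (supp t) -> bip (supp t') ->
  ((\sum_j t j *: u j - \sum_j t' j *: u j)%R <= Lm)%MS -> supp t = supp t'.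
Proof.
move=> t0 t'0 tb t'b /LmP h; apply: Fc_inj => //.
have h1 := open_supp t0 tb (cone0 p0 F0); have h2 := open_supp t'0 t'b h.
rewrite add0r in h1; rewrite subrK in h2.
exact: (fan_uniq subS minF0 F0p0 (Fc_int tb) (Fc_int t'b) h1 h2).
Qed.

(** Supplies both the inequalities and the label clause of [separated]: a label on which [c]
    vanishes involves only rays on which [c] vanishes. *)
Let sign_mem J c i : (forall l, (l <= Lm)%MS -> dot c l = 0) -> bip J ->
  i \in Fc J -> (forall j, j \in J -> 0 <= dot c (u j)) ->
  0 <= dot c (vec i) /\ (dot c (vec i) = 0 ->
    forall J', bip J' -> (forall j, j \in J -> dot c (u j) = 0 -> j \in J') ->
    i \in Fc J').
Proof.
move=> cL Jb iJ cJ; have [t [l [t0 tJ Ll e it]]] := mem_supp Jb iJ.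
have cE : dot c (vec i) = \sum_j t j * dot c (u j).
  by rewrite e dotDr cL ?add0r ?dot_sumr //; apply/LmP.
have ge0 j : 0 <= t j * dot c (u j).
  have [jt|] := boolP (j \in supp t).
    by rewrite mulr_ge0 // cJ // (fintype.subsetP tJ).
  rewrite inE -leNgt => tj; have -> : t j = 0 by apply/le_anti; rewrite tj t0.
  by rewrite mul0r.
rewrite cE; split=> [|/psumr_eq0P h J' J'b J'P]; first exact: sumr_ge0.
apply: (fintype.subsetP _ i it); apply/Fc_le; rewrite ?(bipS tJ) //.
apply/fintype.subsetP => j jt; apply: J'P; first exact: (fintype.subsetP tJ).
have /eqP := h (fun j _ => ge0 j) j isT.
by rewrite mulf_eq0 gt_eqF ?orFb => [/eqP//|]; move: jt; rewrite inE.
Qed.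

Let M s := finset (fun i => [exists k, i \in Fc (bip_cell s k)]).

Let cell_M s k : Fc (bip_cell s k) \subset M s.
Proof. by apply/fintype.subsetP => i h; rewrite inE; apply/existsP; exists k. Qed.

(** The index of such a cell would contain every equatorial vertex, against [bip]. *)
Let M_notin s : M s \notin S.
Proof.
apply/negP => MS.
have iM : interior_face S (M s).
  apply: (interior_face_sup intF0 F0p0 MS).
  exact: fintype.subset_trans (minF0 (Fc_int (bip_cellP s ord0))) (cell_M s ord0).
have [J Jb ME] := Fc_surj iM.
have /andP[_ /existsP[k /negP]] := Jb; apply.
have : bip_cell s (k + 1) \subset J.
  by apply/Fc_le; rewrite ?bip_cellP // -ME cell_M.
move/fintype.subsetP; apply; rewrite inE.
by rewrite -subr_eq0 opprD addrA subrr add0r oppr_eq0 oner_eq0.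
Qed.

Let cover_cell F : F \in S -> exists s k, F \subset Fc (bip_cell s k).
Proof.
move=> /(interior_cover subS intF0 minF0 F0p0)[K /Fc_surj[J Jb ->] FJ].
have [s [k Jsk]] := bip_cell_cover Jb; exists s, k.
by apply: fintype.subset_trans FJ _; apply/Fc_le; rewrite ?bip_cellP.
Qed.

Let setT_notin : [set: label A]%SET \notin S.
Proof.
apply/negP => TS.
have iT : interior_face S [set: label A]%SET.
  by apply: (interior_face_sup intF0 F0p0 TS); apply: finset.subsetT.
have [J Jb TE] := Fc_surj iT.
have /andP[/negP + _] := Jb; apply.
have jJ j : j \in J.
  by rewrite -finset.sub1set; apply/Fc_le; rewrite ?bip1 // -TE finset.subsetT.
by rewrite !jJ.
Qed.

Let M_ge0 s c : (forall l, (l <= Lm)%MS -> dot c l = 0) ->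
  0 <= dot c (u (inl s)) -> (forall k, 0 <= dot c (u (inr k))) ->
  forall i, i \in M s -> 0 <= dot c (vec i).
Proof.
move=> cL cs ck i; rewrite inE => /existsP[k ik].
apply: (sign_mem cL (bip_cellP s k) ik _).1 => -[s'|k']; rewrite inE //.
by move/eqP ->.
Qed.

Let M_neqT s c : (forall l, (l <= Lm)%MS -> dot c l = 0) ->
  0 <= dot c (u (inl s)) -> (forall k, 0 <= dot c (u (inr k))) ->
  dot c (u (inl (~~ s))) < 0 -> M s != [set: label A]%SET.
Proof.
move=> cL cs ck cn; apply/eqP => MT.
have [w [w0 uE]] := Fu (inl (~~ s)).
move: cn; rewrite uE dot_sumr ltNge => /negP; apply; apply: sumr_ge0 => i iF.
apply: mulr_ge0; first exact/ltW/w0.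
by apply: (M_ge0 cL cs ck); rewrite MT finset.in_setT.
Qed.

Let vec_pt c (i : label A) : dot c (pt i) = dot c (vec i) + dot c p0.
Proof. by rewrite /vec dotBr subrK. Qed.

Let separated_vec (N N' : {set label A}) c :
  (forall i, i \in N -> dot c (vec i) <= 0) ->
  (forall i, i \in N' -> 0 <= dot c (vec i)) ->
  (forall i, dot c (vec i) = 0 -> i \in N -> i \in N') ->
  (forall i, dot c (vec i) = 0 -> i \in N' -> i \in N) -> separated N N'.
Proof.
move=> cN cN' h h'; exists c, (dot c p0); split=> i.
- by rewrite vec_pt gerDr; apply: cN.
- by rewrite vec_pt lerDr; apply: cN'.
move/eqP; rewrite vec_pt -subr_eq0 addrK => /eqP e.
by apply/idP/idP; [apply: h|apply: h'].
Qed.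

Let flat_not_coarsest c : (forall l, (l <= Lm)%MS -> dot c l = 0) ->
  (forall k, dot c (u (inr k)) = 0) -> dot c (u (inl true)) < 0 ->
  0 < dot c (u (inl false)) -> ~ coarsest S.
Proof.
move=> cL ck cT cF.
have cL' l : (l <= Lm)%MS -> dot (- c) l = 0.
  by move/cL; rewrite dotNl => ->; rewrite oppr0.
have ck' k : 0 <= dot (- c) (u (inr k)) by rewrite dotNl ck oppr0.
have cT' : 0 < dot (- c) (u (inl true)) by rewrite dotNl oppr_gt0.
have cF' : dot (- c) (u (inl false)) < 0 by rewrite dotNl oppr_lt0.
have sep : separated (M true) (M false).
  apply: (separated_vec (c := c)) => i.
  - by move/(M_ge0 cL' (ltW cT') ck'); rewrite dotNl oppr_ge0.
  - by apply: (M_ge0 cL (ltW cF)) => k; rewrite ck.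
  - move=> ci; rewrite inE => /existsP[k ik].
    apply: (fintype.subsetP (cell_M false k)).
    apply: (sign_mem cL' (bip_cellP true k) ik _).2; last 2 first.
    + exact: bip_cellP.
    + by move=> [s|k']; rewrite !inE // => /eqP-> /eqP; rewrite gt_eqF.
    + by move=> -[s|k'] //; rewrite inE => /eqP ->; rewrite ltW.
    + by rewrite dotNl ci oppr0.
  - move=> ci; rewrite inE => /existsP[k ik].
    apply: (fintype.subsetP (cell_M true k)).
    apply: (sign_mem cL (bip_cellP false k) ik _).2; rewrite ?bip_cellP //.
      by move=> -[s|k']; rewrite ?ck // inE => /eqP ->; rewrite ltW.
    by move=> [s|k']; rewrite !inE // => /eqP-> /eqP; rewrite gt_eqF.
apply: (@merge_not_coarsest _ _ _ S subS [set M true; M false]%SET (M true)).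
- move=> F /cover_cell[s [k Fsk]]; exists (M s).
    by rewrite !inE; case: s {Fsk}; rewrite eqxx ?orbT.
  exact: fintype.subset_trans Fsk (cell_M s k).
- move=> N N'; rewrite !inE => /orP[]/eqP-> /orP[]/eqP-> // _.
    exact: Or32.
  exact: Or33.
- move=> N; rewrite !inE => /orP[]/eqP->.
    exact: M_neqT cL' (ltW cT') ck' cF'.
  by apply: M_neqT cL (ltW cF) _ cT => k; rewrite ck.
- by rewrite !inE eqxx.
exact: M_notin.
Qed.

(** [M s] lies where all [c k] are nonnegative, and the cell [C k] at the other apex lies beyond the
    hyperplane of [c k]. The three cells [C k] are kept unchanged. *)
Let pointed_not_coarsest s (c : 'I_3 -> 'rV[R]_d) : (forall k,
    [/\ forall l, (l <= Lm)%MS -> dot (c k) l = 0,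
        forall j, j != k -> dot (c k) (u (inr j)) = 0,
        0 < dot (c k) (u (inr k)),
        0 < dot (c k) (u (inl s)) & dot (c k) (u (inl (~~ s))) < 0]) ->
  ~ coarsest S.
Proof.
move=> cP; pose C k := Fc (bip_cell (~~ s) k).
have cr k k' : 0 <= dot (c k) (u (inr k')).
  by have [_ h1 h2 _ _] := cP k; have [->|/h1->//] := eqVneq k' k; apply: ltW.
have sep k : separated (C k) (M s).
  have [cL c0 ck cs cn] := cP k.
  have cL' l : (l <= Lm)%MS -> dot (- c k) l = 0.
    by move/cL; rewrite dotNl => ->; rewrite oppr0.
  have cell0 j : j \in bip_cell (~~ s) k -> 0 <= dot (- c k) (u j).
    case: j => [s'|k']; rewrite inE dotNl.
      by move/eqP->; rewrite oppr_ge0 ltW.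
    by move/c0->; rewrite oppr0.
  apply: (separated_vec (c := c k)) => i.
  - move=> ik; have [+ _] := sign_mem cL' (bip_cellP _ _) ik cell0.
    by rewrite dotNl oppr_ge0.
  - by apply: (M_ge0 cL (ltW cs)).
  - move=> ci ik; apply: (fintype.subsetP (cell_M s k)).
    apply: (sign_mem cL' (bip_cellP _ _) ik cell0).2; rewrite ?bip_cellP //.
      by rewrite dotNl ci oppr0.
    move=> [s'|k']; rewrite !inE dotNl // => /eqP-> /eqP.
    by rewrite oppr_eq0 lt_eqF.
  - move=> ci; rewrite inE => /existsP[k1 ik].
    apply: (sign_mem cL (bip_cellP s k1) ik _).2; rewrite ?bip_cellP //.
      by move=> -[s'|k'] //; rewrite inE => /eqP ->; rewrite ltW.
    move=> [s'|k']; rewrite !inE; first by move=> /eqP-> /eqP; rewrite gt_eqF.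
    by move=> _ e; apply/eqP => ek; rewrite ek in e; rewrite e ltxx in ck.
have CS k : C k \in S by case: (Fc_int (bip_cellP (~~ s) k)).
apply: (@merge_not_coarsest _ _ _ S subS (M s |: [set C k | k in 'I_3])%SET (M s)).
- move=> F /cover_cell[s' [k Fsk]]; have [es|es] := eqVneq s' s.
    exists (M s); first exact: setU11.
    by rewrite es in Fsk; apply: fintype.subset_trans Fsk (cell_M s k).
  have {es} es : s' = ~~ s by move: es; case: (s'); case: (s).
  by exists (C k); [apply/setU1r/imset_f|rewrite /C -es].
- move=> N N' /setU1P[->|/imsetP[k _ ->]] /setU1P[->|/imsetP[k' _ ->]] // _.
  + exact: Or33.
  + exact: Or32.
  + exact: Or31.
- move=> N /setU1P[->|/imsetP[k _ ->]].
    by have [cL _ _ cs cn] := cP ord0; apply: M_neqT cL (ltW cs) (cr ord0) cn.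
  by apply: contraNneq setT_notin => <-.
- exact: setU11.
exact: M_notin.
Qed.

Lemma bipyramid_not_coarsest_at : ~ coarsest S.
Proof.
have [[p [p0' Lp]]|nodep] := pselect (exists p : 'I_3 -> R,
    (forall k, 0 < p k) /\ ((\sum_k p k *: u (inr k))%R <= Lm)%MS).
  have [c [cL ck cT cF]] := flat_equator cover uniq_supp p0' Lp.
  exact: (flat_not_coarsest cL ck cT cF).
have [s [c cP]] := pointed_equator cover uniq_supp (fun p hp =>
  introN idP (fun Lp => nodep (ex_intro _ p (conj hp Lp)))).
exact: (pointed_not_coarsest cP).
Qed.

End BipyramidSubdivision.

Lemma bipyramid_not_coarsest (R : realType) (d : nat) (A : pointConfig R d)
    (S : {set {set label A}}) (Fc : {set vtx} -> {set label A}) :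
  subdivision S ->
  (forall J, bip J -> interior_face S (Fc J)) ->
  (forall K, interior_face S K -> exists2 J, bip J & K = Fc J) ->
  (forall J J', bip J -> bip J' -> (Fc J \subset Fc J' <-> J \subset J')) ->
  ~ coarsest S.
Proof.
move=> subS Fc_int Fc_surj Fc_le.
have strict J : bip J -> exists r, strict_hull (Fc J) r.
  move/Fc_int/interior_faceP=> [_ [r Kr _]].
  exact/strict_hull_bary/(hull_neq0 Kr).
have [p0 F0p0] := strict _ bip0.
have /choice[u Fu] : forall j, exists v, open_cone p0 (Fc [set j]%SET) v.
  move=> j; have [r Fr] := strict _ (bip1 j); exists (r - p0).
  by apply: (open_cone_strict ltr01 Fr); rewrite scale1r addrC subrK.
exact: (bipyramid_not_coarsest_at subS Fc_int Fc_surj Fc_le F0p0 Fu).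
Qed.

(** Both [slack_face] and the anti-isomorphism [f] reverse inclusion, so the indexing [Fc] preserves
    it. *)
Lemma prism_not_tight_span (R : realType) (d : nat) (A : pointConfig R d)
    (S : {set {set label A}}) :
  coarsest S -> ~ is_tight_span S (face_complex (prism (@triangle R))).
Proof.
move=> cS [f [fK fS fL]]; have [subS _ _] := cS.
have /choice[Fc FcP] : forall J : {set vtx}, exists F, bip J ->
    interior_face S F /\ f F = slack_face J.
  move=> J; have [Jb|_] := boolP (bip J); last by exists finset.set0.
  by have [F iF fF] := fS _ (slack_face_complex Jb); exists F.
apply: (bipyramid_not_coarsest (Fc := Fc) subS _ _ _ cS).
- by move=> J /FcP[].
- move=> K iK; have [J Jb fJ] := slack_face_surj (fK K iK); exists J => //.
  have [iJ fJ'] := FcP J Jb.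
  apply/eqP; rewrite finset.eqEsubset; apply/andP; split; apply/fL => //;
  by rewrite fJ fJ'.
- move=> J J' Jb J'b; have [iJ fJ] := FcP J Jb; have [iJ' fJ'] := FcP J' J'b.
  by rewrite (fL _ _ iJ iJ') fJ fJ' -slack_face_le.
Qed.

Theorem theorem5p14 (R : realType) :
  (~ (forall (n : nat) (P : set 'rV[R]_n) (k : nat),
        polytope P -> has_dim P k -> (3 <= k)%N ->
        exists (d : nat) (A : pointConfig R d) (S : {set {set label A}}),
          coarsest S /\ is_tight_span S (face_complex P)))
  /\
  (~ (exists (d : nat) (A : pointConfig R d) (S : {set {set label A}}),
        coarsest S /\ is_tight_span S (face_complex (prism (@triangle R))))).
Proof.
split=> [h|[d [A [S [cS]]]]]; last exact: prism_not_tight_span.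
have [d [A [S [cS]]]] := h _ _ _ prism_polytope prism_dim isT.
exact: prism_not_tight_span.
Qed.
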